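(* For every oriented sub-Riemannian Engel structure $(M,\mathcal{D},g)$ with fixed orientation on $\mathcal{D}$ there exists a canonical frame $\{X_1,X_2,X_3,X_4\}$ of $TM$, with $X_1,X_2$ a $g$-orthonormal frame of $\mathcal{D}$, given by the conditions $$[X_1,X_2]=X_3,\qquad [X_1,X_3]=X_4,\qquad [X_2,X_3]\in \mathrm{span}\{X_1,X_2,X_3\},$$ such that the orientations of $\{X_1,X_2,X_3,X_4\}$ and $\{X_1,X_2\}$ are compatible with the orientations of $M$ and $\mathcal{D}$ respectively. Apart from these conditions, the structure equations of the canonical frame are $$\begin{aligned} [X_1,X_4]&=C^1_{14}X_1+T_5X_2+T_3X_3+T_1X_4,\\ [X_2,X_3]&=T_6X_1+T_4X_2+T_2X_3,\\ [X_2,X_4]&=X_1(T_6)X_1+X_1(T_4)X_2+(T_4+X_1(T_2))X_3+T_2X_4,\\ [X_3,X_4]&=C^1_{34}X_1+C^2_{34}X_2+C^3_{34}X_3+(T_4+2X_1(T_2)-X_2(T_1))X_4, \end{aligned}$$ where $$\begin{aligned} C^1_{14}&=\tfrac12\left(T_1T_4+T_1X_1(T_2)-3X_1(T_4)+X_2(T_3)+X_3(T_1)-X_1^2(T_2)\right),\\ C^3_{34}&=-\tfrac12\left(T_1T_4+T_1X_1(T_2)-X_1(T_4)+X_2(T_3)-X_3(T_1)-X_1^2(T_2)\right),\\ C^2_{34}&=T_2T_5-T_3T_4-T_1X_1(T_4)-X_2(T_5)+X_1^2(T_4),\\ C^1_{34}&=T_2C^1_{14}-T_6T_3-T_1X_1(T_6)-X_2(C^1_{14})+X_1^2(T_6).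 \end{aligned}$$ In particular, the structure constants (structure functions) of the frame depend only on $T_i$, $1\le i\le 6$, and their derivatives along the $X_j$.
   Context: A sub-Riemannian Engel structure $(M,\mathcal{D},g)$ is a 4-dimensional manifold $M$ with a rank-2 distribution $\mathcal{D}$ such that $[\mathcal{D},\mathcal{D}]$ has rank 3 and $[\mathcal{D},[\mathcal{D},\mathcal{D}]]$ has rank 4, together with a positive-definite metric $g$ on $\mathcal{D}$. Here $[\mathcal{E},\mathcal{V}]$ denotes the distribution generated by brackets of germs of sections of $\mathcal{E}$ and $\mathcal{V}$. ''Oriented'' means that $M$ carries a fixed orientation. For the frame $\{X_1,X_2,X_3,X_4\}$, the functions $C^k_{ij}$ with $(i,j)\in\{(1,4),(2,3),(2,4),(3,4)\}$ denote the $X_k$-component of $[X_i,X_j]$, and the six basic invariants are $T_1=C_{14}^4$, $T_2=C_{23}^3$, $T_3=C_{14}^3$, $T_4=C_{23}^2$, $T_5=C_{14}^2$, $T_6=C_{23}^1$. $X(f)$ denotes the derivative of a function $f$ along a vector field $X$, and $X^2(f)=X(X(f))$.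
   Formalization: The printed formulas for C^1_{14} and C^3_{34} are false in general; the formal statement adds to each the missing term (1/2)X_1(X_2(T_1) - 2X_1(T_2)), as the Jacobi identity for X_1, X_3, X_4 requires. *)

(* Defs.v *)
From HB Require Import structures.
From mathcomp Require Import all_boot all_order all_algebra.
From mathcomp Require Import all_classical all_reals all_analysis.
Import Order.TTheory GRing.Theory Num.Theory.
Import numFieldNormedType.Exports.

Set Implicit Arguments.
Unset Strict Implicit.
Unset Printing Implicit Defensive.

Local Open Scope classical_set_scope.
Local Open Scope ring_scope.

(* Meant for an open set U of a finite-dimensional V, where it says that the
   Frechet derivatives up to order k exist and are continuous on U. *)
Fixpoint Ck (R : realType) (V W : normedModType R) (k : nat)
    (U : set V) (f : V -> W) : Prop :=
  match k with
  | 0 => forall x, U x -> {for x, continuous f}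
  | k'.+1 => (forall x, U x -> differentiable f x) /\
             (forall v : V, Ck k' U (fun x => 'D_v f x))
  end.

Definition Coo (R : realType) (V W : normedModType R)
    (U : set V) (f : V -> W) : Prop := forall k, Ck k U f.

(* A homeomorphism from the open set [cdom] onto the open set
   [cmap @` cdom]; [cmap] and [cinv] are total, with irrelevant values
   elsewhere. *)
Record chart (R : realType) (n : nat) (M : topologicalType) := Chart {
  cdom : set M;
  cmap : M -> 'rV[R]_n;
  cinv : 'rV[R]_n -> M;
  cdom_open : open cdom;
  cimg_open : open (cmap @` cdom);
  cmapK : forall p, cdom p -> cinv (cmap p) = p;
  cmap_continuous : forall p, cdom p -> {for p, continuous cmap};
  cinv_continuous : forall x, (cmap @` cdom) x -> {for x, continuous cinv}
}.

(* Smooth n-manifolds, presented by a (not necessarily maximal) smooth atlas.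
   [chart_at p] is a choice of a chart around p; it serves only to realise the
   tangent space at p as 'rV[R]_n: a row v stands for the tangent vector
   \sum_i v_i d/dx^i at p in the coordinates x of [chart_at p]. *)
Record manifold (R : realType) (n : nat) := Manifold {
  points :> topologicalType;
  atlas : set (chart R n points);
  chart_at : points -> chart R n points;
  points_hausdorff : hausdorff_space points;
  points_second_countable : @second_countable points;
  chart_at_atlas : forall p, atlas (chart_at p);
  chart_at_dom : forall p, cdom (chart_at p) p;
  transition_smooth : forall c c', atlas c -> atlas c' ->
    Coo (cmap c @` (cdom c `&` cdom c')) (cmap c' \o cinv c)
}.

Section Geometry.
Context {R : realType} {n : nat} {M : manifold R n}.

Definition smooth_fun (O : set M) (f : M -> R) : Prop :=
  forall c, atlas c -> Coo (cmap c @` (O `&` cdom c)) (f \o cinv c).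

Definition vfield := M -> 'rV[R]_n.

(* X(f) *)
Definition dir (X : vfield) (f : M -> R) (p : M) : R :=
  'D_(X p) (f \o cinv (chart_at p)) (cmap (chart_at p) p).

(* The components X(x^i) of X in every chart x are smooth. *)
Definition smooth_vfield (O : set M) (X : vfield) : Prop :=
  forall c, atlas c -> forall i,
    smooth_fun (O `&` cdom c) (dir X (fun q => cmap c q 0 i)).

(* The i-th component of [X, Y] at p is X(Y(x^i)) - Y(X(x^i)), where x is
   [chart_at p]. *)
Definition lie (X Y : vfield) : vfield := fun p =>
  \row_i (dir X (dir Y (fun q => cmap (chart_at p) q 0 i)) p
          - dir Y (dir X (fun q => cmap (chart_at p) q 0 i)) p).

Definition frame_at k (Y : 'I_k -> vfield) (p : M) : k.-tuple 'rV[R]_n :=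
  [tuple Y i p | i < k].

(* The rank may vary and no smoothness is imposed here. *)
Definition tdistribution := M -> {vspace 'rV[R]_n}.

Definition smooth_distribution k (E : tdistribution) : Prop :=
  forall p, exists (O : set M) (Y : 'I_k -> vfield),
    [/\ open O, O p, forall i, smooth_vfield O (Y i) &
        forall q, O q -> basis_of (E q) (frame_at Y q)].

Definition section (O : set M) (E : tdistribution) (X : vfield) : Prop :=
  smooth_vfield O X /\ forall q, O q -> X q \in E q.

(* The smallest subspace containing A. *)
Definition vspan (A : set 'rV[R]_n) : {vspace 'rV[R]_n} :=
  xget 0%VS [set W : {vspace 'rV[R]_n} |
    (forall v, A v -> v \in W) /\
    (forall W' : {vspace 'rV[R]_n},
       (forall v, A v -> v \in W') -> (W <= W')%VS)].

Definition dist_bracket (E F : tdistribution) : tdistribution := fun p =>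
  vspan [set v | exists (O : set M) (X Y : vfield),
    [/\ open O, O p, section O E X, section O F Y & v = lie X Y p]].

(* Only the values of g p on E p x E p matter. *)
Definition metric_on (E : tdistribution)
    (g : M -> 'rV[R]_n -> 'rV[R]_n -> R) : Prop :=
  [/\ forall p u v, u \in E p -> v \in E p -> g p u v = g p v u,
      forall p (a : R) u v w, u \in E p -> v \in E p -> w \in E p ->
        g p (a *: u + v) w = a * g p u w + g p v w,
      forall p u, u \in E p -> u != 0 -> 0 < g p u u &
      forall (O : set M) (X Y : vfield), open O ->
        section O E X -> section O E Y ->
        smooth_fun O (fun q => g q (X q) (Y q))].

(* o p is the set of positively oriented bases of E p. *)
Definition orientation k (E : tdistribution)
    (o : M -> k.-tuple 'rV[R]_n -> Prop) : Prop :=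
  [/\ forall p b, o p b -> basis_of (E p) b,
      forall p (b b' : k.-tuple 'rV[R]_n), o p b -> basis_of (E p) b' ->
        (o p b' <-> 0 < \det (\matrix_(i, j) coord b j (tnth b' i))) &
      forall p, exists (O : set M) (Y : 'I_k -> vfield),
        [/\ open O, O p, forall i, smooth_vfield O (Y i) &
            forall q, O q -> o q (frame_at Y q)]].

(* C^k_{ij}; junk at the points where F is not a frame. *)
Definition structure_fun (F : 'I_n -> vfield) (i j k : 'I_n) (p : M) : R :=
  coord (frame_at F p) k (lie (F i) (F j) p).

End Geometry.

Arguments vfield {R n} M.
Arguments tdistribution {R n} M.

(* 1-based indices in 'I_4 *)
Definition idx (i : nat) : 'I_4 := inord i.-1.
Arguments idx i%_N.

Section Engel.
Context {R : realType} {M : manifold R 4}.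

Definition engel (D : tdistribution M)
    (g : M -> 'rV[R]_4 -> 'rV[R]_4 -> R) : Prop :=
  [/\ smooth_distribution 2 D,
      forall p, \dim (dist_bracket D D p) = 3%N,
      forall p, \dim (dist_bracket D (dist_bracket D D) p) = 4%N &
      metric_on D g].

Definition canonical_frame (D : tdistribution M)
    (g : M -> 'rV[R]_4 -> 'rV[R]_4 -> R)
    (oM : M -> 4.-tuple 'rV[R]_4 -> Prop)
    (oD : M -> 2.-tuple 'rV[R]_4 -> Prop)
    (X : 'I_4 -> vfield M) : Prop :=
  let X1 := X (idx 1) in let X2 := X (idx 2) in
  let X3 := X (idx 3) in let X4 := X (idx 4) in
  [/\ (forall i, smooth_vfield setT (X i)) /\
      (forall p, basis_of fullv (frame_at X p)),
      forall p, [/\ X1 p \in D p, X2 p \in D p, g p (X1 p) (X1 p) = 1,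
                    g p (X2 p) (X2 p) = 1 & g p (X1 p) (X2 p) = 0],
      [/\ lie X1 X2 = X3, lie X1 X3 = X4 &
          forall p, lie X2 X3 p \in <<[:: X1 p; X2 p; X3 p]>>%VS],
      forall p, oM p [tuple X1 p; X2 p; X3 p; X4 p] &
      forall p, oD p [tuple X1 p; X2 p]].

(* T_1, ..., T_6 *)
Definition basic_invariant (X : 'I_4 -> vfield M) (m : 'I_6) : M -> R :=
  let C k i j := structure_fun X (idx i) (idx j) (idx k) in
  tnth [tuple (C 4 1 4)%N; (C 3 2 3)%N; (C 3 1 4)%N;
              (C 2 2 3)%N; (C 2 1 4)%N; (C 1 2 3)%N] m.

End Engel.

(* Universal differential polynomials in T_1, ..., T_6 and the derivations
   X_1, ..., X_4. *)
Inductive dpoly :=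
| DCst of rat
| DInv of 'I_6
| DAdd of dpoly & dpoly
| DMul of dpoly & dpoly
| DDer of 'I_4 & dpoly.

Fixpoint dpoly_eval (R : realType) (M : manifold R 4)
    (X : 'I_4 -> vfield M) (e : dpoly) : M -> R :=
  match e with
  | DCst c => fun=> ratr c
  | DInv m => basic_invariant X m
  | DAdd a b => fun p => dpoly_eval X a p + dpoly_eval X b p
  | DMul a b => fun p => dpoly_eval X a p * dpoly_eval X b p
  | DDer j a => dir (X j) (dpoly_eval X a)
  end.

(* Main.v *)
Require Import Defs.
From HB Require Import structures.
From mathcomp Require Import all_boot all_order all_algebra.
From mathcomp Require Import all_classical all_reals all_analysis.
From mathcomp Require Import ring lra.
Import Order.TTheory GRing.Theory Num.Theory.
Import numFieldNormedType.Exports.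
Local Open Scope classical_set_scope.
Local Open Scope ring_scope.
Set Implicit Arguments.
Unset Strict Implicit.
Unset Printing Implicit Defensive.

(** A row [X p] lists the components of a tangent vector in the chart [chart_at p], and this choice
    of chart may jump with p. Rows at different points cannot be compared, and a smooth field need
    not be a continuous map into rows. Tangent vectors are therefore handled as derivations: by
    [tder_eq] a vector is determined by its action on local smooth functions, and bracket identities
    are verified there. Schwarz's theorem makes the bracket, which is defined by the coordinates of
    one chart, act as a commutator on every smooth function. In dl^3 one factor comes from the pair
    X1, X2, one from X3 and one from X4. As dl > 0, the determinant has the sign of a al + b be, so
    the orientation of M decides the sign of X1, and that of D then decides the sign of X2. The
    first two Jacobi identities express [X2, X4] and [X3, X4] through [X1, X4] and [X2, X3], with
    C^1_14 still free. The X4-component of the third is a linear equation for 2 C^1_14, hence the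
    halves. It involves the X1-derivative of the X4-component of [X3, X4], which is the origin of
    the term [E]. *)

(** Let Z1, Z2 be a local positively oriented frame of D and Z3 = [Z1, Z2].  For
    another frame X1 = a Z1 + b Z2, X2 = c Z1 + d Z2 with dl = a d - b c > 0,
    [X1, X2] = dl Z3 modulo D, and the brackets [X1, X3], [X2, X3] are dl times
    a [Z1, Z3] + b [Z2, Z3] and c [Z1, Z3] + d [Z2, Z3] modulo [D, D].  The rank
    conditions say that Z1, Z2, Z3 are independent and that the components
    (al, be) of [Z1, Z3], [Z2, Z3] transverse to them do not both vanish.  Hence
    [X2, X3] in span {X1, X2, X3} means c al + d be = 0, which fixes the line
    of X2; orthonormality leaves a sign, and as the determinant of
    (X1, X2, X3, X4) is dl^3 (a al + b be), the orientation of M fixes it.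
    Uniqueness lets the local frames be glued.  The structure equations are the
    Jacobi identities of (X1, X2, X3), (X1, X2, X4) and (X1, X3, X4). *)

(** * Calculus on open sets *)

Section Calculus.
Context {R : realType}.
Implicit Types (V W : normedModType R).

Lemma near_eq_differentiable V W (f g : V -> W) x :
  (\forall y \near x, f y = g y) -> differentiable f x -> differentiable g x.
Proof.
move=> fg df.
have dfc : continuous ('d f x : V -> W) by exact: diff_continuous.
(* The first-order expansion of f at x is also one of g, and [diff_unique] then identifies the
   differential of g with that of f. *)
suff E : g \o shift x = cst (g x) + ('d f x : V -> W) +o_ 0 id.
  by apply/diff_locallyP; rewrite (diff_unique dfc E); split.
have /eqaddoP H := diff_locally df.
apply/eqaddoP => e e0; have := H e e0.
rewrite -(nbhs_singleton fg).
have fg0 : \forall y \near (0 : V), f (y + x) = g (y + x).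
  by move: fg; rewrite (near_shift 0) subr0.
by apply: filterS2 fg0 => y /= Ey; rewrite !fctE /= Ey.
Qed.

(** As U is open, agreement on U is agreement near each of its points, so the derivatives agree on U
    too and the induction on the order goes through. *)
Lemma Ck_congr V W k (U : set V) (f g : V -> W) : open U ->
  (forall x, U x -> f x = g x) -> Ck k U f -> Ck k U g.
Proof.
move=> oU; have nU x : U x -> \forall y \near x, U y by move=> Ux; exact: open_nbhs_nbhs.
elim: k f g => [|k IH] f g fg /=.
  move=> fc x Ux; suff : g @ x --> g x by [].
  rewrite -(fg x Ux).
  apply: cvg_trans (fc x Ux); apply: near_eq_cvg.
  by near=> y; apply: fg; near: y; exact: nU.
move=> [df dDf]; have nfg x : U x -> \forall y \near x, f y = g y.
  by move=> Ux; near=> y; apply: fg; near: y; exact: nU.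
split=> [x Ux|v]; first exact: near_eq_differentiable (nfg x Ux) (df x Ux).
by apply: IH (dDf v) => x Ux; apply: near_eq_derive; exact: nfg.
Unshelve. all: by end_near. Qed.

(** Every clause of [Ck] is a condition at single points of U, so the neighbourhoods may depend on
    the point. *)
Lemma Ck_local V W k (U : set V) (f : V -> W) :
  (forall x, U x -> exists U', [/\ open U', U' x & Ck k U' f]) -> Ck k U f.
Proof.
elim: k f => [|k IH] f /= H.
  by move=> x /H[U' [_ Ux]]; exact.
split=> [x /H[U' [_ Ux [df _]]]|v]; first exact: df.
by apply: IH => x /H[U' [oU Ux [_ dDf]]]; exists U'; split.
Qed.

Lemma Ck_sub V W k (U U' : set V) (f : V -> W) : U' `<=` U ->
  Ck k U f -> Ck k U' f.
Proof.
move=> UU; elim: k f => [|k IH] f /=; first by move=> H x /UU; exact: H.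
by move=> [df dDf]; split=> [x /UU|v]; [exact: df|exact: IH].
Qed.

Lemma Ck_pred V W k (U : set V) (f : V -> W) : Ck k.+1 U f -> Ck k U f.
Proof.
elim: k f => [|k IH] f; first by move=> [df _] x Ux; exact/differentiable_continuous/df.
by move=> [df dDf]; split=> // v; exact: IH.
Qed.

Lemma Ck_cst V W k (U : set V) (a : W) : Ck k U (fun=> a).
Proof.
elim: k a => [|k IH] a /=; first by move=> x _; exact: cst_continuous.
split=> [x _|v]; first exact: differentiable_cst.
have -> : (fun x : V => 'D_v (fun=> a) x) = (fun=> 0).
  by apply/funext => x; exact: derive_cst.
exact: IH.
Qed.

Lemma Ck_add V W k (U : set V) (f g : V -> W) : open U ->
  Ck k U f -> Ck k U g -> Ck k U (fun x => f x + g x).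
Proof.
move=> oU; elim: k f g => [|k IH] f g /=.
  by move=> fc gc x Ux; exact: continuousD (fc x Ux) (gc x Ux).
move=> [df dDf] [dg dDg]; split=> [x Ux|v].
  exact: differentiableD (df x Ux) (dg x Ux).
apply: Ck_congr (IH _ _ (dDf v) (dDg v)) => // x Ux.
by rewrite (deriveD (diff_derivable (df x Ux)) (diff_derivable (dg x Ux))).
Qed.

(** The product rule multiplies the derivative of one factor by the other factor itself, so the
    induction also needs f and g at the lower order; [Ck_pred] supplies this. *)
Lemma Ck_mul V k (U : set V) (f g : V -> R) : open U ->
  Ck k U f -> Ck k U g -> Ck k U (fun x => f x * g x).
Proof.
move=> oU; elim: k f g => [|k IH] f g.
  by move=> fc gc x Ux; apply: continuousM; [exact: fc|exact: gc].
move=> Cf Cg; have := Ck_pred Cf; have := Ck_pred Cg; move: Cf Cg.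
move=> [df dDf] [dg dDg] Cg Cf; split=> [x Ux|v].
  exact: differentiableM (df x Ux) (dg x Ux).
apply: (@Ck_congr _ _ _ _ (fun x => f x * 'D_v g x + g x * 'D_v f x)) => //.
  move=> x Ux.
  by rewrite (deriveM (diff_derivable (df x Ux)) (diff_derivable (dg x Ux))).
apply: Ck_add => //; first exact: IH Cf (dDg v).
exact: IH Cg (dDf v).
Qed.

(** The derivative of 1/f is the derivative of f times -1/f^2, and 1/f is already of class k by
    induction. [Ck_sqrt] follows the same pattern. *)
Lemma Ck_inv V k (U : set V) (f : V -> R) : open U ->
  (forall x, U x -> f x != 0) -> Ck k U f -> Ck k U (fun x => (f x)^-1).
Proof.
move=> oU f0; elim: k f f0 => [|k IH] f f0.
  by move=> fc x Ux; apply: continuousV; [exact: f0|exact: fc].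
move=> Cf; have Ci := IH f f0 (Ck_pred Cf); case: Cf => df dDf; split=> [x Ux|v].
  by apply: differentiableV; [exact: df|exact: f0].
apply: (@Ck_congr _ _ _ _ (fun x => -1 * ((f x)^-1 * (f x)^-1) * 'D_v f x)) => //.
  move=> x Ux; rewrite (deriveV (f0 x Ux) (diff_derivable (df x Ux))).
  by rewrite mulN1r expr2 invfM.
apply: Ck_mul (dDf v) => //; apply: Ck_mul => //; first exact: Ck_cst.
exact: Ck_mul.
Qed.

Lemma derive_comp_real V (f : V -> R) (h : R -> R) (dh : R) x v :
  differentiable f x -> is_derive (f x) 1 h dh ->
  differentiable (h \o f) x /\ 'D_v (h \o f) x = dh * 'D_v f x.
Proof.
move=> df hd; have dhf : differentiable h (f x) by exact/derivable1_diffP.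
have dc : differentiable (h \o f) x by exact: differentiable_comp.
split=> //; rewrite deriveE // diff_comp //= deriveE //.
rewrite [X in 'd h _ X](_ : _ = 'd f x v *: (1 : R)); last first.
  by rewrite /GRing.scale /= mulr1.
have Dh : 'D_1 h (f x) = dh by exact: derive_val.
by rewrite linearZ /= -(deriveE (1 : R) dhf) Dh mulrC.
Qed.

Lemma Ck_sqrt V k (U : set V) (f : V -> R) : open U ->
  (forall x, U x -> 0 < f x) -> Ck k U f -> Ck k U (fun x => Num.sqrt (f x)).
Proof.
move=> oU f0; elim: k f f0 => [|k IH] f f0.
  move=> fc x Ux; apply: continuous_comp (fc x Ux) _.
  exact: sqrt_continuous.
move=> Cf; have Ci := IH f f0 (Ck_pred Cf); case: Cf => df dDf; split=> [x Ux|v].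
  by have [] := derive_comp_real 0 (df x Ux) (is_derive1_sqrt (f0 x Ux)).
apply: (@Ck_congr _ _ _ _ (fun x => (2 * Num.sqrt (f x))^-1 * 'D_v f x)) => //.
  move=> x Ux.
  by have [_ ->] := derive_comp_real v (df x Ux) (is_derive1_sqrt (f0 x Ux)).
apply: Ck_mul (dDf v) => //; apply: Ck_inv => //.
  by move=> x Ux; rewrite mulf_neq0 // ?pnatr_eq0 // gt_eqF // sqrtr_gt0 f0.
by apply: Ck_mul => //; exact: Ck_cst.
Qed.

Lemma derive_coord V n (f : V -> 'rV[R]_n) x v i : differentiable f x ->
  differentiable (fun y => f y 0 i) x /\
  'D_v (fun y => f y 0 i) x = ('D_v f x) 0 i.
Proof.
move=> df; split.
  exact: (differentiable_comp df (differentiable_coord (f x) 0 i)).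
by rewrite (derive_mx (diff_derivable df)) mxE.
Qed.

Lemma Ck_coord V n k (U : set V) (f : V -> 'rV[R]_n) i : open U ->
  Ck k U f -> Ck k U (fun x => f x 0 i).
Proof.
move=> oU; elim: k f => [|k IH] f.
  move=> fc x Ux.
  exact: (continuous_comp (fc x Ux) (@coord_continuous _ _ _ 0 i _)).
move=> [df dDf]; split=> [x Ux|v]; first by have [] := derive_coord 0 i (df x Ux).
apply: Ck_congr (IH _ (dDf v)) => // x Ux.
by have [_ ->] := derive_coord v i (df x Ux).
Qed.

Lemma deriveZdir V W (f : V -> W) x v a : differentiable f x ->
  'D_(a *: v) f x = a *: 'D_v f x.
Proof. by move=> df; rewrite !deriveE // linearZ. Qed.

Lemma deriveDdir V W (f : V -> W) x u v : differentiable f x ->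
  'D_(u + v) f x = 'D_u f x + 'D_v f x.
Proof. by move=> df; rewrite !deriveE // linearD. Qed.

Lemma derive_chain V n (phi : V -> 'rV[R]_n) (f : 'rV[R]_n -> R) x v :
  differentiable phi x -> differentiable f (phi x) ->
  'D_v (f \o phi) x =
    \sum_i 'D_v (fun y => phi y 0 i) x * 'D_(delta_mx 0 i) f (phi x).
Proof.
move=> dphi df; rewrite deriveE; last exact: differentiable_comp.
rewrite diff_comp //= -(deriveE v dphi) [X in 'd f _ X]row_sum_delta linear_sum.
by apply: eq_bigr => i _; rewrite linearZ /= -deriveE // (derive_coord v i dphi).2.
Qed.

(* The second difference of f along h u, h v is h^2 D_v D_u f at a nearby point,
   by two applications of the mean value theorem. *)
Lemma second_difference V (U : set V) (f : V -> R) (x u v : V) (h : R) :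
  0 < h ->
  (forall a b, 0 <= a <= h -> 0 <= b <= h -> U (a *: u + b *: v + x)) ->
  (forall y, U y -> differentiable f y) ->
  (forall y, U y -> differentiable (fun z => 'D_u f z) y) ->
  exists a b, [/\ 0 <= a <= h, 0 <= b <= h &
    f (h *: u + h *: v + x) - f (h *: u + x) - (f (h *: v + x) - f x) =
    h ^+ 2 * 'D_v (fun z => 'D_u f z) (a *: u + b *: v + x)].
Proof.
move=> h0 HU df dDf.
(* Both applications of the mean value theorem are one-dimensional, to the restriction of a function
   to a line. *)
have line (F : V -> R) (w y : V) r : differentiable F (r *: w + y) ->
    is_derive r 1 (fun t : R => F (t *: w + y)) ('D_w F (r *: w + y)).
  move=> dF.
  pose l := fun t : R => t *: w + y.
  have [dl Dl] : differentiable l r /\ 'd l r 1 = w.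
    have D : is_diff r l ( *:%R^~ w + 0) by exact: is_diffD.
    by split; [exact: ex_diff|rewrite diff_val /= !fctE scale1r addr0].
  have dFl : differentiable (F \o l) r by exact: differentiable_comp.
  apply: DeriveDef; first exact: diff_derivable.
  by rewrite deriveE // diff_comp //= Dl deriveE.
pose phi r := f (r *: u + (h *: v + x)) - f (r *: u + x).
pose dphi r := 'D_u f (r *: u + (h *: v + x)) - 'D_u f (r *: u + x).
have hh : 0 <= h <= h by rewrite (ltW h0) lexx.
have h00 : 0 <= (0 : R) <= h by rewrite lexx (ltW h0).
have Uh a : 0 <= a <= h -> U (a *: u + (h *: v + x)).
  by move=> ah; rewrite addrA; exact: HU.
have U0 a : 0 <= a <= h -> U (a *: u + x).
  by move=> ah; have := HU a 0 ah h00; rewrite scale0r addr0.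
have Dphi r : 0 <= r <= h -> is_derive r 1 phi (dphi r).
  by move=> rh; apply: is_deriveB; apply: line; apply: df; [exact: Uh|exact: U0].
have [||a ain] := @MVT R phi dphi 0 h h0.
- by move=> r; rewrite in_itv /= => /andP[r0 rh]; apply: Dphi; rewrite !ltW.
- apply: derivable_within_continuous => r; rewrite in_itv /= => rh.
  by have [] := Dphi r rh.
have ah : 0 <= a <= h by move: ain; rewrite in_itv /= => /andP[? ?]; rewrite !ltW.
rewrite subr0 /phi /dphi scale0r !add0r => E1.
(* The mean value [dphi a] is itself an increment of the derivative along u, taken in the direction
   v; a second mean value is taken for it. *)
pose psi s := 'D_u f (s *: v + (a *: u + x)).
have Us s : 0 <= s <= h -> U (s *: v + (a *: u + x)).
  by move=> sh; rewrite addrCA addrA; exact: HU.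
have Dpsi s : 0 <= s <= h ->
    is_derive s 1 psi ('D_v (fun z => 'D_u f z) (s *: v + (a *: u + x))).
  by move=> sh; apply: (line (fun z => 'D_u f z)); apply/dDf/Us.
have [||b bin] := @MVT R psi
  (fun s => 'D_v (fun z => 'D_u f z) (s *: v + (a *: u + x))) 0 h h0.
- by move=> r; rewrite in_itv /= => /andP[r0 rh]; apply: Dpsi; rewrite !ltW.
- apply: derivable_within_continuous => r; rewrite in_itv /= => rh.
  by have [] := Dpsi r rh.
have bh : 0 <= b <= h by move: bin; rewrite in_itv /= => /andP[? ?]; rewrite !ltW.
rewrite subr0 /psi scale0r add0r => E2.
exists a, b; split=> //.
rewrite addrA in E1; rewrite E1 [a *: u + (_ + _)]addrCA E2.
by rewrite -[a *: u + b *: v]addrC -addrA expr2; ring.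
Qed.

(** The points y and z may differ: the mean value arguments for the two mixed derivatives end at
    different intermediate points. *)
Lemma continuous_eq_near V (A B : V -> R) (x : V) :
  {for x, continuous A} -> {for x, continuous B} ->
  (forall d, 0 < d -> exists y z, [/\ ball x d y, ball x d z & A y = B z]) ->
  A x = B x.
Proof.
move=> cA cB H.
apply/eqP; rewrite -subr_eq0 -normr_le0; apply/ler_addgt0Pl => e e0; rewrite addr0.
have e2 : 0 < e / 2 by rewrite divr_gt0.
have nA : \forall y \near x, `|A x - A y| < e / 2 by move/cvgrPdist_lt : cA; exact.
have nB : \forall y \near x, `|B x - B y| < e / 2 by move/cvgrPdist_lt : cB; exact.
have /nbhs_ballP[d /= d0 Hd] : \forall y \near x, `|A x - A y| < e / 2 /\ `|B x - B y| < e / 2.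
  exact: filterI nA nB.
have [y [z [yd zd E]]] := H d d0.
have [Ay _] := Hd y yd; have [_ Bz] := Hd z zd.
have -> : A x - B x = (A x - A y) - (B x - B z) by rewrite E; ring.
rewrite (le_trans (ler_normB _ _)) //; lra.
Qed.

(** The second difference is symmetric in u and v. Divided by h^2 it is thus a value of each mixed
    derivative, at points as close to x as desired, and both mixed derivatives are continuous. *)
Lemma schwarz V (U : set V) (f : V -> R) (x u v : V) : open U -> U x ->
  Ck 2 U f ->
  'D_v (fun z => 'D_u f z) x = 'D_u (fun z => 'D_v f z) x.
Proof.
move=> oU Ux [df dDf].
apply: (@continuous_eq_near _ (fun z => 'D_v (fun z => 'D_u f z) z)
  (fun z => 'D_u (fun z => 'D_v f z) z)).
- by move: (proj2 (dDf u) v x Ux).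
- by move: (proj2 (dDf v) u x Ux).
move=> e e0.
have /nbhs_ballP[d1 /= d10 Hd1] : \forall y \near x, U y by exact: open_nbhs_nbhs.
pose d := Num.min e d1.
have d0 : 0 < d by rewrite lt_min e0.
pose N := `|u| + `|v| + 1.
have N0 : 0 < N by rewrite ltr_wpDl // addr_ge0.
(* For 0 <= a, b <= h the point a u + b v + x is within h N = d/2 of x. The summand 1 in N keeps it
   positive when u = v = 0. *)
pose h := d / (2 * N).
have h0 : 0 < h by rewrite divr_gt0 // mulr_gt0.
have near_x a b : 0 <= a <= h -> 0 <= b <= h -> ball x d (a *: u + b *: v + x).
  move=> /andP[a0 ah] /andP[b0 bh]; rewrite -ball_normE /= distrC addrK.
  apply: (@le_lt_trans _ _ (h * N)).
    rewrite (le_trans (ler_normD _ _)) // !normrZ !ger0_norm // /N.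
    have := normr_ge0 u; have := normr_ge0 v; set nu := `|u|; set nv := `|v|.
    by move=> *; nra.
  have -> : h * N = d / 2 by rewrite /h; field; rewrite gt_eqF.
  by lra.
have near_U a b : 0 <= a <= h -> 0 <= b <= h -> U (a *: u + b *: v + x).
  move=> ah bh; apply: Hd1; apply: le_ball (near_x a b ah bh).
  by rewrite ge_min lexx orbT.
have near_e a b : 0 <= a <= h -> 0 <= b <= h -> ball x e (a *: u + b *: v + x).
  by move=> ah bh; apply: le_ball (near_x a b ah bh); rewrite ge_min lexx.
have [a [b [ah bh E1]]] := second_difference h0 near_U df (proj1 (dDf u)).
have near_U' r s : 0 <= r <= h -> 0 <= s <= h -> U (r *: v + s *: u + x).
  by move=> rh sh; rewrite [r *: v + _]addrC; exact: near_U.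
have [b' [a' [bh' ah' E2]]] := second_difference h0 near_U' df (proj1 (dDf v)).
exists (a *: u + b *: v + x), (b' *: v + a' *: u + x); split.
- exact: near_e.
- by rewrite [b' *: v + _]addrC; exact: near_e.
have h2 : h ^+ 2 != 0 by rewrite expf_neq0 // gt_eqF.
apply: (mulfI h2).
have swap (p q r s : R) : p - q - (r - s) = p - r - (q - s) by ring.
apply: etrans (esym E1) (etrans _ E2).
by rewrite [h *: v + h *: u]addrC swap.
Qed.

End Calculus.

(** * Smooth functions and tangent vectors *)

Section SmoothFunctions.
Context {R : realType} {n : nat} {M : manifold R n}.
Implicit Types (O : set M) (f g : M -> R) (c : chart R n M).

(** The maps of a chart are total and continuous only where they are meaningful, so openness comes
    from pulling O back along [cinv] inside the open image of the chart. *)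
Lemma chart_image_open c O : open O -> open (cmap c @` (O `&` cdom c)).
Proof.
move=> oO; have oOc : open (O `&` cdom c) by apply: openI => //; exact: cdom_open.
rewrite openE => _ [p [Op cp] <-].
have pim : (cmap c @` cdom c) (cmap c p) by exists p.
have n1 : nbhs (cmap c p) (cmap c @` cdom c).
  by apply: open_nbhs_nbhs; split=> //; exact: cimg_open.
have n2 : nbhs (cmap c p) (cinv c @^-1` (O `&` cdom c)).
  apply: (cinv_continuous pim); rewrite cmapK //.
  by apply: open_nbhs_nbhs.
apply: filterS2 n1 n2 => y [q cq <-]; rewrite /preimage /= cmapK // => Oq.
by exists q.
Qed.

Lemma smooth_fun_sub O U f : U `<=` O -> smooth_fun O f -> smooth_fun U f.
Proof.
move=> OO sf c ac k; apply: Ck_sub (sf c ac k) => _ [p [Op cp] <-].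
by exists p => //; split=> //; exact: OO.
Qed.

Lemma smooth_fun_local O f :
  (forall p, O p -> exists U, [/\ open U, U p & smooth_fun U f]) ->
  smooth_fun O f.
Proof.
move=> H c ac k; apply: Ck_local => _ [p [Op cp] <-].
have [U [oO' Op' sf]] := H p Op.
exists (cmap c @` (U `&` cdom c)); split; first exact: chart_image_open.
  by exists p.
exact: sf.
Qed.

Lemma smooth_fun_congr O f g : open O -> (forall p, O p -> f p = g p) ->
  smooth_fun O f -> smooth_fun O g.
Proof.
move=> oO fg sf c ac k; apply: Ck_congr (sf c ac k); first exact: chart_image_open.
by move=> _ [p [Op cp] <-] /=; rewrite cmapK // fg.
Qed.

Lemma smooth_cst O (a : R) : smooth_fun O (fun=> a).
Proof. by move=> c ac k; exact: Ck_cst. Qed.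

Lemma smooth_add O f g : open O -> smooth_fun O f -> smooth_fun O g ->
  smooth_fun O (fun p => f p + g p).
Proof.
move=> oO sf sg c ac k.
by apply: Ck_add; [exact: chart_image_open|exact: sf|exact: sg].
Qed.

Lemma smooth_mul O f g : open O -> smooth_fun O f -> smooth_fun O g ->
  smooth_fun O (fun p => f p * g p).
Proof.
move=> oO sf sg c ac k.
by apply: Ck_mul; [exact: chart_image_open|exact: sf|exact: sg].
Qed.

Lemma smooth_opp O f : open O -> smooth_fun O f -> smooth_fun O (fun p => - f p).
Proof.
move=> oO sf; apply: (@smooth_fun_congr _ (fun p => -1 * f p)) => //.
  by move=> p _; rewrite mulN1r.
by apply: smooth_mul => //; exact: smooth_cst.
Qed.

Lemma smooth_sub O f g : open O -> smooth_fun O f -> smooth_fun O g ->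
  smooth_fun O (fun p => f p - g p).
Proof. by move=> oO sf sg; apply: smooth_add => //; exact: smooth_opp. Qed.

Lemma smooth_inv O f : open O -> (forall p, O p -> f p != 0) ->
  smooth_fun O f -> smooth_fun O (fun p => (f p)^-1).
Proof.
move=> oO f0 sf c ac k; apply: Ck_inv (sf c ac k); first exact: chart_image_open.
by move=> _ [p [Op cp] <-] /=; rewrite cmapK //; exact: f0.
Qed.

Lemma smooth_sqrt O f : open O -> (forall p, O p -> 0 < f p) ->
  smooth_fun O f -> smooth_fun O (fun p => Num.sqrt (f p)).
Proof.
move=> oO f0 sf c ac k; apply: Ck_sqrt (sf c ac k); first exact: chart_image_open.
by move=> _ [p [Op cp] <-] /=; rewrite cmapK //; exact: f0.
Qed.

Lemma smooth_sum O (I : Type) (r : seq I) (P : pred I) (F : I -> M -> R) :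
  open O -> (forall i, P i -> smooth_fun O (F i)) ->
  smooth_fun O (fun p => \sum_(i <- r | P i) F i p).
Proof.
move=> oO sF; elim: r => [|i r IH].
  apply: (@smooth_fun_congr _ (fun=> 0)) => //; last exact: smooth_cst.
  by move=> p _; rewrite big_nil.
case Pi: (P i); last first.
  by apply: smooth_fun_congr IH => // p _; rewrite big_cons Pi.
apply: smooth_fun_congr (smooth_add oO (sF i Pi) IH) => // p _.
by rewrite big_cons Pi.
Qed.

Lemma smooth_prod O (I : Type) (r : seq I) (P : pred I) (F : I -> M -> R) :
  open O -> (forall i, P i -> smooth_fun O (F i)) ->
  smooth_fun O (fun p => \prod_(i <- r | P i) F i p).
Proof.
move=> oO sF; elim: r => [|i r IH].
  apply: (@smooth_fun_congr _ (fun=> 1)) => //; last exact: smooth_cst.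
  by move=> p _; rewrite big_nil.
case Pi: (P i); last first.
  by apply: smooth_fun_congr IH => // p _; rewrite big_cons Pi.
apply: smooth_fun_congr (smooth_mul oO (sF i Pi) IH) => // p _.
by rewrite big_cons Pi.
Qed.

Lemma smooth_det O k (A : M -> 'M[R]_k) : open O ->
  (forall i j, smooth_fun O (fun p => A p i j)) ->
  smooth_fun O (fun p => \det (A p)).
Proof.
move=> oO sA; apply: smooth_sum => // s _; apply: smooth_mul => //.
  exact: smooth_cst.
exact: smooth_prod.
Qed.

(** Read in another chart, this function is a component of a transition map. *)
Lemma smooth_coord c i : atlas c -> smooth_fun (cdom c) (fun q => cmap c q 0 i).
Proof.
move=> ac c' ac' k; have /(_ k) := transition_smooth ac' ac; rewrite setIC => H.
apply: Ck_coord H; apply: chart_image_open; exact: cdom_open.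
Qed.

Lemma smooth_differentiable O f p c : open O -> smooth_fun O f -> O p ->
  atlas c -> cdom c p -> differentiable (f \o cinv c) (cmap c p).
Proof. by move=> oO sf Op ac cp; have [d _] := sf c ac 1; apply: d; exists p. Qed.

End SmoothFunctions.

(** * Tangent vectors as derivations *)

Section TangentVectors.
Context {R : realType} {n : nat} {M : manifold R n}.
Implicit Types (O : set M) (f g : M -> R) (c : chart R n M) (X Y Z : vfield M).

(** The derivation given by a single vector at p, with no field around it; a bracket at p can be
    tested in this form. *)
Definition tder p (v : 'rV[R]_n) f : R :=
  'D_v (f \o cinv (chart_at p)) (cmap (chart_at p) p : 'rV[R]_n).

Lemma dirE X f (p : M) : dir X f p = tder p (X p) f.
Proof. by []. Qed.

Let atp (p : M) : atlas (chart_at p). Proof. exact: chart_at_atlas. Qed.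
Let dmp (p : M) : cdom (chart_at p) p. Proof. exact: chart_at_dom. Qed.

Lemma near_chart O f g (p : M) c : open O -> O p -> cdom c p ->
  (forall q, O q -> f q = g q) ->
  \forall x \near (cmap c p), (f \o cinv c) x = (g \o cinv c) x.
Proof.
move=> oO Op cp fg.
have : nbhs (cmap c p) (cmap c @` (O `&` cdom c)).
  by apply: open_nbhs_nbhs; split; [exact: chart_image_open|exists p].
by apply: filterS => _ [q [Oq cq] <-] /=; rewrite cmapK // fg.
Qed.

Lemma tder_loc O f g p v : open O -> O p -> (forall q, O q -> f q = g q) ->
  tder p v f = tder p v g.
Proof. by move=> oO Op fg; apply: near_eq_derive; exact: near_chart fg. Qed.

Lemma dir_loc O X f g (p : M) : open O -> O p -> (forall q, O q -> f q = g q) ->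
  dir X f p = dir X g p.
Proof. exact: tder_loc. Qed.

Section At.
Variables (O : set M) (p : M).
Hypotheses (oO : open O) (Op : O p).

Lemma tderDv f v w : smooth_fun O f -> tder p (v + w) f = tder p v f + tder p w f.
Proof. by move=> sf; apply: deriveDdir; exact: smooth_differentiable sf Op _ _. Qed.

Lemma tderZv f a v : smooth_fun O f -> tder p (a *: v) f = a * tder p v f.
Proof. by move=> sf; apply: deriveZdir; exact: smooth_differentiable sf Op _ _. Qed.

Lemma tder0v f : tder p 0 f = 0.
Proof. exact: derive0. Qed.

Lemma tder_sumv f (I : Type) (r : seq I) (P : pred I) (v : I -> 'rV[R]_n) :
  smooth_fun O f ->
  tder p (\sum_(i <- r | P i) v i) f = \sum_(i <- r | P i) tder p (v i) f.
Proof.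
move=> sf; elim: r => [|i r IH]; first by rewrite !big_nil tder0v.
by rewrite !big_cons; case: ifP => // _; rewrite tderDv // IH.
Qed.

Lemma tder_cst a v : tder p v (fun=> a) = 0.
Proof. exact: derive_cst. Qed.

Lemma tder_add f g v : smooth_fun O f -> smooth_fun O g ->
  tder p v (fun q => f q + g q) = tder p v f + tder p v g.
Proof.
move=> sf sg; rewrite /tder -deriveD //; apply: diff_derivable.
  exact: smooth_differentiable sf Op _ _.
exact: smooth_differentiable sg Op _ _.
Qed.

Lemma tder_mul f g v : smooth_fun O f -> smooth_fun O g ->
  tder p v (fun q => f q * g q) = f p * tder p v g + g p * tder p v f.
Proof.
move=> sf sg.
rewrite /tder [LHS](@deriveM _ _ (f \o _) (g \o _)).
- by rewrite /= cmapK.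
- by apply: diff_derivable; exact: smooth_differentiable sf Op _ _.
- by apply: diff_derivable; exact: smooth_differentiable sg Op _ _.
Qed.

Lemma tder_opp f v : smooth_fun O f -> tder p v (fun q => - f q) = - tder p v f.
Proof.
move=> sf; have -> : (fun q => - f q) = (fun q => -1 * f q).
  by apply/funext => q; rewrite mulN1r.
rewrite tder_mul //; last exact: smooth_cst.
by rewrite tder_cst mulr0 addr0 mulN1r.
Qed.

Lemma tder_sub f g v : smooth_fun O f -> smooth_fun O g ->
  tder p v (fun q => f q - g q) = tder p v f - tder p v g.
Proof. by move=> sf sg; rewrite tder_add ?tder_opp //; exact: smooth_opp. Qed.

(** This is the chain rule for the transition from [chart_at p] to c. It lets one fixed chart serve
    all points near p, although each vector is read in the chart of its own base point. *)
Lemma tder_chart f c v : smooth_fun O f -> atlas c -> cdom c p ->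
  tder p v f = \sum_i tder p v (fun q => cmap c q 0 i) *
                 'D_(delta_mx 0 i) (f \o cinv c) (cmap c p).
Proof.
move=> sf ac cp; rewrite /tder.
set c0 := chart_at p; set phi := cmap c \o cinv c0.
have c0p : cdom c0 p by exact: dmp.
have phip : phi (cmap c0 p) = cmap c p by rewrite /phi /= cmapK.
have dphi : differentiable phi (cmap c0 p).
  have [d _] := transition_smooth (atp p) ac 1; apply: d.
  by exists p.
have near_phi : \forall x \near cmap c0 p, (f \o cinv c0) x = ((f \o cinv c) \o phi) x.
  have : nbhs (cmap c0 p) (cmap c0 @` (cdom c `&` cdom c0)).
    apply: open_nbhs_nbhs; split; last by exists p.
    by apply: chart_image_open; exact: cdom_open.
  by apply: filterS => _ [q [cq c0q] <-]; rewrite /phi /= !cmapK.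
rewrite (near_eq_derive v near_phi) derive_chain //; last first.
  by rewrite phip; exact: smooth_differentiable sf Op _ _.
by rewrite phip.
Qed.

End At.

Lemma tder_chart_at p v i : tder p v (fun q => cmap (chart_at p) q 0 i) = v 0 i.
Proof.
have nid : \forall x \near cmap (chart_at p) p,
    cmap (chart_at p) (cinv (chart_at p) x) 0 i = x 0 i.
  have : nbhs (cmap (chart_at p) p) (cmap (chart_at p) @` cdom (chart_at p)).
    by apply: open_nbhs_nbhs; split; [exact: cimg_open|exists p].
  by apply: filterS => _ [q cq <-]; rewrite cmapK.
rewrite /tder (near_eq_derive v nid).
have [_ ->] := @derive_coord _ _ n id (cmap (chart_at p) p) v i ex_diff.
by rewrite derive_id.
Qed.

(** The coordinates of [chart_at p] are among the test functions and recover the entries of the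
    row. *)
Lemma tder_eq p v w : (forall O f, open O -> O p -> smooth_fun O f ->
  tder p v f = tder p w f) -> v = w.
Proof.
move=> H; apply/rowP => i; rewrite -!(tder_chart_at p).
apply: H (smooth_coord i (atp p)) => //; exact: cdom_open.
Qed.

Lemma tder_eq_chart p c v w : atlas c -> cdom c p ->
  (forall i, tder p v (fun q => cmap c q 0 i) = tder p w (fun q => cmap c q 0 i)) ->
  v = w.
Proof.
move=> ac cp H; apply: (@tder_eq p) => O f oO Op sf.
rewrite !(tder_chart oO Op _ sf ac cp).
by apply: eq_bigr => i _; rewrite H.
Qed.

Lemma smooth_vfield_sub O U X : U `<=` O -> smooth_vfield O X -> smooth_vfield U X.
Proof.
move=> OO sX c ac i; apply: smooth_fun_sub (sX c ac i) => p [Op cp].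
by split=> //; exact: OO.
Qed.

Lemma smooth_vfield_local O X :
  (forall p, O p -> exists U, [/\ open U, U p & smooth_vfield U X]) ->
  smooth_vfield O X.
Proof.
move=> H c ac i; apply: smooth_fun_local => p [/H[U [oO' Op' sX]] cp].
exists (U `&` cdom c); split=> //; last exact: sX.
by apply: openI => //; exact: cdom_open.
Qed.

Lemma smooth_vfield_congr O X Y : open O -> (forall p, O p -> X p = Y p) ->
  smooth_vfield O X -> smooth_vfield O Y.
Proof.
move=> oO XY sX c ac i; apply: smooth_fun_congr (sX c ac i).
  by apply: openI => //; exact: cdom_open.
by move=> p [Op _]; rewrite !dirE XY.
Qed.

(** In a chart, X f is the sum of the X(x^i) times the partial derivatives of f. The former are
    smooth by definition of a smooth field, the latter of class k because f is of class k+1. *)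
Lemma smooth_dir O X f : open O -> smooth_vfield O X -> smooth_fun O f ->
  smooth_fun O (dir X f).
Proof.
move=> oO sX sf c ac k.
have oU : open (cmap c @` (O `&` cdom c)) by exact: chart_image_open.
pose G i x := (dir X (fun q => cmap c q 0 i) \o cinv c) x *
              'D_(delta_mx 0 i) (f \o cinv c) x.
apply: (@Ck_congr _ _ _ _ _ (fun x => \sum_i G i x)) => //.
  move=> _ [p [Op cp] <-]; rewrite /G /= cmapK // dirE (tder_chart oO Op _ sf ac cp).
  by [].
have sG i : Ck k (cmap c @` (O `&` cdom c)) (G i).
  apply: Ck_mul => //; last by have [_] := sf c ac k.+1; exact.
  have := sX c ac i c ac k; congr (Ck k (_ @` _) _).
  by rewrite -setIA setIid.
elim: (index_enum _) => [|i r IH].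
  apply: (@Ck_congr _ _ _ _ _ (fun=> 0)) => //; last exact: Ck_cst.
  by move=> x _; rewrite big_nil.
by apply: Ck_congr (Ck_add oU (sG i) IH) => // x _; rewrite big_cons.
Qed.

Lemma smooth_vfield_add O X Y : open O -> smooth_vfield O X -> smooth_vfield O Y ->
  smooth_vfield O (fun p => X p + Y p).
Proof.
move=> oO sX sY c ac i.
have oOc : open (O `&` cdom c) by apply: openI => //; exact: cdom_open.
apply: smooth_fun_congr (smooth_add oOc (sX c ac i) (sY c ac i)) => // p [Op cp].
by rewrite !dirE (tderDv (@cdom_open _ _ _ c) cp) //; exact: smooth_coord.
Qed.

Lemma smooth_vfield_scale O f X : open O -> smooth_fun O f -> smooth_vfield O X ->
  smooth_vfield O (fun p => f p *: X p).
Proof.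
move=> oO sf sX c ac i.
have oOc : open (O `&` cdom c) by apply: openI => //; exact: cdom_open.
have sf' : smooth_fun (O `&` cdom c) f by apply: smooth_fun_sub sf => p [].
apply: smooth_fun_congr (smooth_mul oOc sf' (sX c ac i)) => // p [Op cp].
by rewrite !dirE (tderZv (@cdom_open _ _ _ c) cp) //; exact: smooth_coord.
Qed.

Section DirRules.
Variables (O : set M) (p : M).
Hypotheses (oO : open O) (Op : O p).

Lemma dir_cst a X : dir X (fun=> a) p = 0.
Proof. exact: tder_cst. Qed.

Lemma dir_add f g X : smooth_fun O f -> smooth_fun O g ->
  dir X (fun q => f q + g q) p = dir X f p + dir X g p.
Proof. exact: tder_add. Qed.

Lemma dir_mul f g X : smooth_fun O f -> smooth_fun O g ->
  dir X (fun q => f q * g q) p = f p * dir X g p + g p * dir X f p.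
Proof. exact: tder_mul. Qed.

Lemma dir_sub f g X : smooth_fun O f -> smooth_fun O g ->
  dir X (fun q => f q - g q) p = dir X f p - dir X g p.
Proof. exact: tder_sub. Qed.

Lemma dirDv f X Y : smooth_fun O f ->
  dir (fun q => X q + Y q) f p = dir X f p + dir Y f p.
Proof. exact: tderDv. Qed.

Lemma dirZv f a X : smooth_fun O f ->
  dir (fun q => a q *: X q) f p = a p * dir X f p.
Proof. exact: tderZv. Qed.

End DirRules.

Lemma dir_eqX X Y f p : X p = Y p -> dir X f p = dir Y f p.
Proof. by rewrite /dir => ->. Qed.

Lemma lieE X Y p i : lie X Y p 0 i =
  dir X (dir Y (fun q => cmap (chart_at p) q 0 i)) p -
  dir Y (dir X (fun q => cmap (chart_at p) q 0 i)) p.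
Proof. by rewrite /lie mxE. Qed.

(* Unification otherwise unfolds it down to limits, at a prohibitive cost. *)
#[local] Opaque dir.

(** A bracket depends on the germs of both fields. This is what allows a section of the distribution
    to be replaced by its expression in a local frame. *)
Lemma lie_loc O X X' Y Y' p : open O -> O p ->
  (forall q, O q -> X q = X' q) -> (forall q, O q -> Y q = Y' q) ->
  lie X Y p = lie X' Y' p.
Proof.
move=> oO Op XX YY.
have dd (Z Z' W W' : vfield M) f : Z p = Z' p -> (forall q, O q -> W q = W' q) ->
    dir Z (dir W f) p = dir Z' (dir W' f) p.
  move=> ZZ WW.
  rewrite (dir_eqX (dir W f) ZZ).
  apply: (@dir_loc O Z' (dir W f) (dir W' f) p oO Op) => q Oq.
  exact: (dir_eqX f (WW q Oq)).
apply/rowP => i.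
apply: etrans (lieE X Y p i) (etrans _ (esym (lieE X' Y' p i))).
by rewrite (dd X X' Y Y' _ (XX p Op) YY) (dd Y Y' X X' _ (YY p Op) XX).
Qed.

Lemma lieC X Y p : lie X Y p = - lie Y X p.
Proof.
apply/rowP => i; rewrite [RHS]mxE; apply: etrans (lieE X Y p i) _.
by apply: etrans (esym (opprB _ _)) _; congr (- _); exact: esym (lieE Y X p i).
Qed.

Lemma liexx X p : lie X X p = 0.
Proof. by apply/rowP => i; rewrite [RHS]mxE; apply: etrans (lieE X X p i) (subrr _). Qed.

Section Brackets.
Variables (O : set M).
Hypothesis oO : open O.

Lemma dir_chart X f c (p : M) : O p -> smooth_fun O f -> atlas c -> cdom c p ->
  dir X f p = \sum_i dir X (fun q => cmap c q 0 i) p *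
                'D_(delta_mx 0 i) (f \o cinv c) (cmap c p).
Proof. by move=> Op sf ac cp; rewrite dirE (tder_chart oO Op _ sf ac cp). Qed.

(* The second-order terms of X (Y f) are symmetric in X and Y by Schwarz. *)
Lemma tder_lie X Y f p : smooth_vfield O X -> smooth_vfield O Y ->
  smooth_fun O f -> O p ->
  tder p (lie X Y p) f = dir X (dir Y f) p - dir Y (dir X f) p.
Proof.
move=> sX sY sf Op.
set c := chart_at p; have ac : atlas c by exact: atp.
have cp : cdom c p by exact: dmp.
pose U := O `&` cdom c.
have oU : open U by apply: openI => //; exact: cdom_open.
have Up : U p by split.
pose F := f \o cinv c.
pose x i q := cmap c q 0 i.
have sx i : smooth_fun U (x i).
  by apply: smooth_fun_sub (smooth_coord i ac) => q [].
have [dF dDF] := sf c ac 2.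
have pI : (cmap c @` (O `&` cdom c)) (cmap c p) by exists p.
(* The product rule applied to the chart expression of W f gives a first-order part and a second
   derivative of F along the constant vectors [Z p] and [W p]. Since c is [chart_at p], the
   components of W at p in this chart are the entries of the row [W p]. *)
have second Z W : smooth_vfield O Z -> smooth_vfield O W ->
    dir Z (dir W f) p =
    (\sum_i dir Z (dir W (x i)) p * 'D_(delta_mx 0 i) F (cmap c p)) +
    'D_(Z p) (fun z => 'D_(W p) F z) (cmap c p).
  move=> sZ sW.
  have sWx i : smooth_fun U (dir W (x i)).
    have sWU : smooth_vfield U W by apply: smooth_vfield_sub sW => q [].
    exact: smooth_dir oU sWU (sx i).
  pose G i y := (dir W (x i) \o cinv c) y * 'D_(delta_mx 0 i) F y.
  have dG1 i : differentiable (dir W (x i) \o cinv c) (cmap c p).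
    exact: smooth_differentiable (sWx i) Up ac cp.
  have dG2 v : differentiable (fun z => 'D_v F z) (cmap c p).
    by have [d _] := dDF v; apply: d.
  have nE : \forall y \near cmap c p, (dir W f \o cinv c) y = \sum_i G i y.
    have : nbhs (cmap c p) (cmap c @` U).
      by apply: open_nbhs_nbhs; split=> //; exact: chart_image_open.
    apply: filterS => _ [q [Oq cq] <-]; rewrite /G /= cmapK //.
    by rewrite (dir_chart _ Oq sf ac cq).
  have nE2 : \forall y \near cmap c p,
      'D_(W p) F y = \sum_i W p 0 i * 'D_(delta_mx 0 i) F y.
    have : nbhs (cmap c p) (cmap c @` (O `&` cdom c)).
      by apply: open_nbhs_nbhs; split=> //; exact: chart_image_open.
    apply: filterS => y Iy; have dFy := dF y Iy.
    rewrite deriveE // [in LHS](row_sum_delta (W p)) linear_sum.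
    by apply: eq_bigr => i _; rewrite linearZ /= -deriveE.
  rewrite [LHS](near_eq_derive _ nE) (near_eq_derive _ nE2).
  have sumE (H : 'I_n -> 'rV[R]_n -> R) :
      (fun y => \sum_i H i y) = \sum_i H i.
    by apply/funext => y; rewrite fct_sumE.
  rewrite !sumE !derive_sum; first last.
  - by move=> i; apply: diff_derivable; exact: differentiableM.
  - move=> i; apply: diff_derivable; apply: differentiableM => //.
  rewrite -big_split /=; apply: eq_bigr => i _.
  rewrite (deriveM (diff_derivable (dG1 i)) (diff_derivable (dG2 (delta_mx 0 i)))).
  rewrite [X in _ = _ + X]deriveMl; last exact: diff_derivable.
  have W0 : (dir W (x i) \o cinv c) (cmap c p) = W p 0 i.
    apply: etrans (congr1 (dir W (x i)) (cmapK cp)) _.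
    exact: etrans (dirE _ _ _) (tder_chart_at p (W p) i).
  have Z0 : dir Z (dir W (x i)) p = 'D_(Z p) (dir W (x i) \o cinv c) (cmap c p).
    exact: dirE.
  by rewrite addrC W0 Z0 [X in X + _]mulrC.
have cancel (a b d e : R) : d = e -> (a + d) - (b + e) = a - b by move=> ->; ring.
have sw := schwarz (Y p) (X p) (chart_image_open oO) pI (sf c ac 2).
apply: esym.
apply: etrans (congr2 (fun a b => a - b) (second X Y sX sY) (second Y X sY sX)) _.
apply: etrans (cancel _ _ _ _ sw) _.
apply: etrans (esym (sumrB _ _ _ _)) _.
apply: etrans _ (esym (tder_chart oO Op _ sf ac cp)).
apply: eq_bigr => i _; apply: etrans (esym (mulrBl _ _ _)) _.
apply: (congr1 (fun a => a * _)).
exact: esym (etrans (tder_chart_at p _ i) (lieE X Y p i)).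
Qed.

Lemma dir_lie X Y f p : smooth_vfield O X -> smooth_vfield O Y ->
  smooth_fun O f -> O p ->
  dir (lie X Y) f p = dir X (dir Y f) p - dir Y (dir X f) p.
Proof. by move=> sX sY sf Op; apply: etrans (dirE _ _ _) _; exact: tder_lie. Qed.

End Brackets.
End TangentVectors.

(** * Lie brackets *)

#[local] Opaque dir lie tder.

Section LieCalculus.
Context {R : realType} {n : nat} {M : manifold R n}.
Variable (O : set M).
Hypothesis oO : open O.
Implicit Types (f : M -> R) (X Y Z : vfield M) (p : M).

(** The way brackets are computed below: a candidate w is compared with the commutator on test
    functions whose domain lies inside the set where X and Y are smooth. *)
Lemma lie_char X Y p w : smooth_vfield O X -> smooth_vfield O Y -> O p ->
  (forall U h, open U -> U `<=` O -> U p -> smooth_fun U h ->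
    tder p w h = dir X (dir Y h) p - dir Y (dir X h) p) ->
  lie X Y p = w.
Proof.
move=> sX sY Op H; apply: (@tder_eq _ _ _ p) => U h oU Up sh.
have oV : open (O `&` U) by exact: openI.
have shV : smooth_fun (O `&` U) h by apply: smooth_fun_sub sh => q [].
have VO : O `&` U `<=` O by move=> q [].
have Vp : (O `&` U) p by split.
apply: etrans _ (esym (H _ _ oV VO Vp shV)).
exact: (tder_lie oV (smooth_vfield_sub VO sX) (smooth_vfield_sub VO sY) shV Vp).
Qed.

Lemma smooth_lie X Y : smooth_vfield O X -> smooth_vfield O Y ->
  smooth_vfield O (lie X Y).
Proof.
move=> sX sY c ac i.
pose U := O `&` cdom c.
have oU : open U by apply: openI => //; exact: cdom_open.
have UO : U `<=` O by move=> q [].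
have sx : smooth_fun U (fun q => cmap c q 0 i).
  by apply: smooth_fun_sub (smooth_coord i ac) => q [].
have sXU := smooth_vfield_sub UO sX; have sYU := smooth_vfield_sub UO sY.
have sXY := smooth_dir oU sXU (smooth_dir oU sYU sx).
have sYX := smooth_dir oU sYU (smooth_dir oU sXU sx).
apply: smooth_fun_congr (smooth_sub oU sXY sYX) => // q Uq.
exact: esym (dir_lie oU sXU sYU sx Uq).
Qed.

Lemma lie_add_r X Y Z p : smooth_vfield O X -> smooth_vfield O Y ->
  smooth_vfield O Z -> O p ->
  lie X (fun q => Y q + Z q) p = lie X Y p + lie X Z p.
Proof.
move=> sX sY sZ Op; apply: (lie_char sX (smooth_vfield_add oO sY sZ) Op).
move=> U h oU UO Up sh.
have sXU := smooth_vfield_sub UO sX; have sYU := smooth_vfield_sub UO sY.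
have sZU := smooth_vfield_sub UO sZ.
have sYh := smooth_dir oU sYU sh; have sZh := smooth_dir oU sZU sh.
have sXh := smooth_dir oU sXU sh.
have E1 : dir X (dir (fun q => Y q + Z q) h) p = dir X (dir Y h) p + dir X (dir Z h) p.
  apply: etrans _ (dir_add oU Up _ sYh sZh).
  by apply: (dir_loc _ oU Up) => q Uq; exact: (dirDv oU Uq).
have E2 : dir (fun q => Y q + Z q) (dir X h) p = dir Y (dir X h) p + dir Z (dir X h) p.
  exact: (dirDv oU Up).
(* The algebra is proved for arbitrary reals and then instantiated, so that [ring] never meets a
   derivation. The same device recurs below. *)
have alg (A B L a1 a2 b1 b2 l1 l2 : R) : A = a1 + a2 -> B = b1 + b2 ->
  L = l1 + l2 -> l1 = a1 - b1 -> l2 = a2 - b2 -> L = A - B by move=> *; subst; ring.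
exact: (alg _ _ _ _ _ _ _ _ _ E1 E2 (tderDv oU Up (lie X Y p) (lie X Z p) sh)
  (tder_lie oU sXU sYU sh Up) (tder_lie oU sXU sZU sh Up)).
Qed.

Lemma lie_scale_r X f Y p : smooth_vfield O X -> smooth_fun O f ->
  smooth_vfield O Y -> O p ->
  lie X (fun q => f q *: Y q) p = f p *: lie X Y p + dir X f p *: Y p.
Proof.
move=> sX sf sY Op; apply: (lie_char sX (smooth_vfield_scale oO sf sY) Op).
move=> U h oU UO Up sh.
have sXU := smooth_vfield_sub UO sX; have sYU := smooth_vfield_sub UO sY.
have sfU := smooth_fun_sub UO sf.
have sYh := smooth_dir oU sYU sh; have sXh := smooth_dir oU sXU sh.
have E1 : dir X (dir (fun q => f q *: Y q) h) p =
    f p * dir X (dir Y h) p + dir Y h p * dir X f p.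
  apply: etrans _ (dir_mul oU Up _ sfU sYh).
  by apply: (dir_loc _ oU Up) => q Uq; exact: (dirZv oU Uq).
have E2 : dir (fun q => f q *: Y q) (dir X h) p = f p * dir Y (dir X h) p.
  exact: (dirZv oU Up).
have E3 := tderDv oU Up (f p *: lie X Y p) (dir X f p *: Y p) sh.
have E4 := tderZv oU Up (f p) (lie X Y p) sh.
have E5 := tderZv oU Up (dir X f p) (Y p) sh.
have alg (A B L a d l b' l1 l2 u v e : R) : A = u * a + d * v -> B = u * b' ->
  L = l1 + l2 -> l1 = u * l -> l2 = v * e -> l = a - b' -> d = e -> L = A - B.
  by move=> *; subst; ring.
exact: (alg _ _ _ _ _ _ _ _ _ _ _ _ E1 E2 E3 E4 E5 (tder_lie oU sXU sYU sh Up)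
  (dirE _ _ _)).
Qed.

Lemma lie_add_l X Y Z p : smooth_vfield O X -> smooth_vfield O Y ->
  smooth_vfield O Z -> O p ->
  lie (fun q => Y q + Z q) X p = lie Y X p + lie Z X p.
Proof.
move=> sX sY sZ Op; apply: etrans (lieC _ _ _) _.
apply: etrans (congr1 -%R (lie_add_r sX sY sZ Op)) (etrans (opprD _ _) _).
exact: congr2 (esym (lieC _ _ _)) (esym (lieC _ _ _)).
Qed.

Lemma lie_scale_l X f Y p : smooth_vfield O X -> smooth_fun O f ->
  smooth_vfield O Y -> O p ->
  lie (fun q => f q *: Y q) X p = f p *: lie Y X p - dir X f p *: Y p.
Proof.
move=> sX sf sY Op; apply: etrans (lieC _ _ _) _.
apply: etrans (congr1 -%R (lie_scale_r sX sf sY Op)) (etrans (opprD _ _) _).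
apply: (congr1 (fun v => v - _)); apply: etrans (esym (scalerN _ _)) _.
exact: congr1 (esym (lieC _ _ _)).
Qed.

(** Brackets act on functions as commutators of operators, and for commutators this is an identity
    between compositions of three operators. *)
Lemma jacobi X Y Z p : smooth_vfield O X -> smooth_vfield O Y ->
  smooth_vfield O Z -> O p ->
  lie X (lie Y Z) p = lie (lie X Y) Z p + lie Y (lie X Z) p.
Proof.
move=> sX sY sZ Op; apply: (lie_char sX (smooth_lie sY sZ) Op).
move=> U h oU UO Up sh.
have sXU := smooth_vfield_sub UO sX; have sYU := smooth_vfield_sub UO sY.
have sZU := smooth_vfield_sub UO sZ.
have sLU A B : smooth_vfield O A -> smooth_vfield O B -> smooth_vfield U (lie A B).
  by move=> sA sB; apply: smooth_vfield_sub UO _; exact: smooth_lie.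
have sd A k : smooth_vfield U A -> smooth_fun U k -> smooth_fun U (dir A k).
  exact: smooth_dir.
have lieh A B k q : smooth_vfield U A -> smooth_vfield U B -> smooth_fun U k ->
    U q -> dir (lie A B) k q = dir A (dir B k) q - dir B (dir A k) q.
  by move=> sA sB sk Uq; exact: (dir_lie oU sA sB sk Uq).
have dlieh A B C k : smooth_vfield U A -> smooth_vfield U B -> smooth_vfield U C ->
    smooth_fun U k -> dir C (dir (lie A B) k) p =
      dir C (dir A (dir B k)) p - dir C (dir B (dir A k)) p.
  move=> sA sB sC sk.
  apply: etrans _ (dir_sub oU Up _ (sd _ _ sA (sd _ _ sB sk)) (sd _ _ sB (sd _ _ sA sk))).
  by apply: (dir_loc _ oU Up) => q Uq; exact: lieh.
have E0 := tderDv oU Up (lie (lie X Y) Z p) (lie Y (lie X Z) p) sh.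
have E1 := tder_lie oU (sLU _ _ sX sY) sZU sh Up.
have E2 := tder_lie oU sYU (sLU _ _ sX sZ) sh Up.
have F1 := lieh X Y _ p sXU sYU (sd _ _ sZU sh) Up.
have F2 := lieh X Z _ p sXU sZU (sd _ _ sYU sh) Up.
have F3 := lieh Y Z _ p sYU sZU (sd _ _ sXU sh) Up.
have G1 := dlieh X Y Z h sXU sYU sZU sh.
have G2 := dlieh X Z Y h sXU sZU sYU sh.
have G3 := dlieh Y Z X h sYU sZU sXU sh.
have alg (L l1 l2 xy xz yz d1 d2 d3 a b c d e f : R) : L = l1 + l2 ->
    l1 = xy - d1 -> l2 = d2 - xz -> xy = a - b -> xz = c - d -> yz = e - f ->
    d1 = d - f -> d2 = b - e -> d3 = a - c -> L = d3 - yz.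
  by move=> *; subst; ring.

exact: (alg _ _ _ _ _ _ _ _ _ _ _ _ _ _ _ E0 E1 E2 F1 F2 F3 G1 G2 G3).
Qed.

End LieCalculus.

(** * Smooth dependence of coordinates in a frame *)

Section Coordinates.
Context {R : realType} {n : nat} {M : manifold R n}.
Variable (O : set M).
Hypothesis oO : open O.
Implicit Types (f : M -> R) (X Y Z : vfield M) (p : M).

Lemma frame_atE k (Y : 'I_k -> vfield M) p (i : 'I_k) : (frame_at Y p)`_i = Y i p.
Proof. by rewrite -tnth_nth tnth_mktuple. Qed.

(** In a chart the relation reads xX = a F, where F is k by n and need not be square. Multiplying by
    the transpose of F gives a square system with the Gram matrix G of the rows of F, which is
    invertible because these rows are independent over the reals. *)
Lemma smooth_coefs k (Y : 'I_k -> vfield M) (X : vfield M) (a : M -> 'I_k -> R) :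
  (forall i, smooth_vfield O (Y i)) -> smooth_vfield O X ->
  (forall q, O q -> free (frame_at Y q)) ->
  (forall q, O q -> X q = \sum_i a q i *: Y i q) ->
  forall i, smooth_fun O (fun q => a q i).
Proof.
move=> sY sX fY XY i; apply: smooth_fun_local => p Op.
pose c := chart_at p; have ac : atlas c by exact: chart_at_atlas.
have cp : cdom c p by exact: chart_at_dom.
pose U := O `&` cdom c.
have oU : open U by apply: openI => //; exact: cdom_open.
exists U; split=> //.
pose x j q := cmap c q 0 j.
have sx j : smooth_fun (cdom c) (x j) by exact: smooth_coord.
pose F q : 'M[R]_(k, n) := \matrix_(i, j) dir (Y i) (x j) q.
pose xX q : 'rV[R]_n := \row_j dir X (x j) q.
pose ra q : 'rV[R]_k := \row_j a q j.
pose G q := F q *m (F q)^T.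
have comp q (v : 'I_k -> R) j : U q ->
    tder q (\sum_i v i *: Y i q) (x j) = ((\row_i v i) *m F q) 0 j.
  move=> Uq; apply: etrans (tder_sumv (@cdom_open _ _ _ c) Uq.2 _ _ _ (sx j)) _.
  rewrite mxE; apply: eq_bigr => l _; rewrite !mxE.
  apply: etrans (tderZv (@cdom_open _ _ _ c) Uq.2 _ _ (sx j)) _.
  by apply: (congr1 ( *%R (v l))); exact: esym (dirE _ _ _).
have xXE q : U q -> xX q = ra q *m F q.
  move=> Uq; apply/rowP => j; rewrite [LHS]mxE; apply: etrans _ (comp q (a q) j Uq).
  by apply: etrans (dirE _ _ _) _; rewrite (XY q Uq.1).
(* If u G = 0, then the sum of the squares of the entries of u F vanishes, so u F = 0. These entries
   are the chart components of the combination of the Y i with coefficients u, which contradicts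
   freeness. *)
have detG q : U q -> \det (G q) != 0.
  move=> Uq; apply/negP => /eqP /eqP /det0P[u u0 uG].
  have uF : u *m F q = 0.
    have : (u *m F q) *m (u *m F q)^T = 0 by rewrite trmx_mul mulmxA -(mulmxA u) uG mul0mx.
    move=> /matrixP /(_ 0 0); rewrite mxE [RHS]mxE => /eqP; rewrite psumr_eq0; last first.
      by move=> j _; rewrite [X in _ * X]mxE -expr2 sqr_ge0.
    move=> /allP H; apply/rowP => j; have := H j (mem_index_enum j).
    by rewrite [X in _ * X]mxE -expr2 sqrf_eq0 => /eqP ->; rewrite mxE.
  have sum0 : \sum_i u 0 i *: Y i q = 0.
    apply: (tder_eq_chart ac Uq.2) => j.
    apply: etrans (comp q (u 0) j Uq) _.
    have -> : (\row_i u 0 i) = u by apply/rowP => l; rewrite mxE.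
    by rewrite uF mxE; exact: esym (tder0v _ _).
  have /freeP fr := fY q Uq.1.
  move: u0; rewrite (_ : u = 0) ?eqxx //; apply/rowP => l; rewrite [RHS]mxE.
  by apply: fr; rewrite -[RHS]sum0; apply: eq_bigr => l' _; rewrite frame_atE.
(* Cramer's rule: the product of a G with the adjugate of G is det(G) a, so a is a rational
   expression in the smooth components of X and of the Y i. *)
pose b q := (\det (G q))^-1 * (xX q *m (F q)^T *m \adj (G q)) 0 i.
apply: (@smooth_fun_congr _ _ _ _ b) => //.
  move=> q Uq; rewrite /b (xXE q Uq) -(mulmxA (ra q)) -mulmxA mul_mx_adj.
  by rewrite mul_mx_scalar !mxE mulrA mulVf ?detG // mul1r.
have sxU j : smooth_fun U (x j) by apply: smooth_fun_sub (sx j) => q [].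
have sF l j : smooth_fun U (fun q => F q l j).
  apply: (@smooth_fun_congr _ _ _ _ (dir (Y l) (x j))) => //.
    by move=> q _; rewrite mxE.
  have sYU : smooth_vfield U (Y l) by apply: smooth_vfield_sub (sY l) => q [].
  exact: smooth_dir oU sYU (sxU j).
have sG l j : smooth_fun U (fun q => G q l j).
  apply: (@smooth_fun_congr _ _ _ _ (fun q => \sum_m F q l m * F q j m)) => //.
    move=> q _; rewrite [RHS]mxE; apply: eq_bigr => m _.
    by congr (_ * _); rewrite [RHS]mxE.
  by apply: smooth_sum => // m _; apply: smooth_mul.
have sx' j : smooth_fun U (fun q => xX q 0 j).
  apply: (@smooth_fun_congr _ _ _ _ (dir X (x j))) => //.
    by move=> q _; rewrite mxE.
  have sXU : smooth_vfield U X by apply: smooth_vfield_sub sX => q [].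
  exact: smooth_dir oU sXU (sxU j).
have sAdj l j : smooth_fun U (fun q => (\adj (G q)) l j).
  apply: (@smooth_fun_congr _ _ _ _ (fun q => cofactor (G q) j l)) => //.
    by move=> q _; rewrite mxE.
  apply: smooth_mul => //; first exact: smooth_cst.
  apply: smooth_det => // i' j'.
  apply: (@smooth_fun_congr _ _ _ _ (fun q => G q (lift j i') (lift l j'))) => //.
  by move=> q _; rewrite [RHS]mxE [RHS]mxE.
apply: smooth_mul => //; first by apply: smooth_inv => //; exact: smooth_det.
apply: (@smooth_fun_congr _ _ _ _
  (fun q => \sum_m (\sum_j xX q 0 j * F q m j) * (\adj (G q)) m i)) => //.
  move=> q _; rewrite [RHS]mxE; apply: eq_bigr => m _; congr (_ * _).
  rewrite [RHS]mxE; apply: eq_bigr => j _; congr (_ * _).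
  by rewrite [RHS]mxE.
by apply: smooth_sum => // m _; apply: smooth_mul => //; apply: smooth_sum => // j _;
  apply: smooth_mul.
Qed.

Lemma smooth_coord_frame k (Y : 'I_k -> vfield M) (X : vfield M) i :
  (forall i, smooth_vfield O (Y i)) -> smooth_vfield O X ->
  (forall q, O q -> free (frame_at Y q)) ->
  (forall q, O q -> X q \in <<frame_at Y q>>%VS) ->
  smooth_fun O (fun q => coord (frame_at Y q) i (X q)).
Proof.
move=> sY sX fY XY.
apply: (@smooth_coefs k Y X (fun q i => coord (frame_at Y q) i (X q))) => // q Oq.
rewrite [LHS](coord_span (XY q Oq)).
by apply: eq_bigr => j _; rewrite frame_atE.
Qed.

End Coordinates.

Lemma span2P (K : fieldType) (V : vectType K) (u v w : V) :
  reflect (exists a b, w = a *: u + b *: v) (w \in <<[:: u; v]>>%VS).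
Proof.
apply: (iffP idP) => [|[a [b ->]]].
  rewrite span_cons span_seq1 => /memv_addP[x /vlineP[a ->] [y /vlineP[b ->] ->]].
  by exists a, b.
by apply: memvD; apply: memvZ; apply: memv_span; rewrite !inE eqxx ?orbT.
Qed.

Lemma span3P (K : fieldType) (V : vectType K) (u v w x : V) :
  reflect (exists a b c, x = a *: u + b *: v + c *: w) (x \in <<[:: u; v; w]>>%VS).
Proof.
apply: (iffP idP) => [|[a [b [c ->]]]].
  rewrite span_cons => /memv_addP[y /vlineP[a ->] [z /span2P[b [c ->]] ->]].
  by exists a, b, c; rewrite addrA.
apply: memvD; [apply: memvD|]; apply: memvZ; apply: memv_span;
  by rewrite !inE eqxx ?orbT.
Qed.

(** * Brackets of linear combinations of fields *)

Section Combinations.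
Context {R : realType} {n : nat} {M : manifold R n}.
Implicit Types (O U : set M) (f : M -> R) (X Y Z : vfield M) (p : M).

Lemma frame2 X Y p : frame_at (tnth [tuple X; Y]) p = [tuple X p; Y p].
Proof. by apply/val_inj; rewrite /= enum_ordSl enum_ordSl enum_ord0. Qed.

Lemma frame3 X Y Z p : frame_at (tnth [tuple X; Y; Z]) p = [tuple X p; Y p; Z p].
Proof. by apply/val_inj; rewrite /= enum_ordSl enum_ordSl enum_ordSl enum_ord0. Qed.

Lemma frame4 X Y Z T p :
  frame_at (tnth [tuple X; Y; Z; T]) p = [tuple X p; Y p; Z p; T p].
Proof. by apply/val_inj; rewrite /= 4!enum_ordSl enum_ord0. Qed.

Lemma smooth_tuple2 O X Y (i : 'I_2) : smooth_vfield O X -> smooth_vfield O Y ->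
  smooth_vfield O (tnth [tuple X; Y] i).
Proof.
move=> sX sY; case: i => [[|[|m]] mi]; [exact: sX|exact: sY|].
by exfalso; move: mi.
Qed.

Lemma smooth_tuple3 O X Y Z (i : 'I_3) : smooth_vfield O X -> smooth_vfield O Y ->
  smooth_vfield O Z -> smooth_vfield O (tnth [tuple X; Y; Z] i).
Proof.
move=> sX sY sZ; case: i => [[|[|[|m]]] mi]; [exact: sX|exact: sY|exact: sZ|].
by exfalso; move: mi.
Qed.

Lemma smooth_tuple4 O X Y Z T (i : 'I_4) : smooth_vfield O X -> smooth_vfield O Y ->
  smooth_vfield O Z -> smooth_vfield O T ->
  smooth_vfield O (tnth [tuple X; Y; Z; T] i).
Proof.
move=> sX sY sZ sT.
case: i => [[|[|[|[|m]]]] mi]; [exact: sX|exact: sY|exact: sZ|exact: sT|].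
by exfalso; move: mi.
Qed.

Section On.
Variable O : set M.
Hypothesis oO : open O.

Lemma smooth_vfield_comb2 a b X Y : smooth_fun O a -> smooth_fun O b ->
  smooth_vfield O X -> smooth_vfield O Y ->
  smooth_vfield O (fun q => a q *: X q + b q *: Y q).
Proof.
move=> sa sb sX sY.
exact: (smooth_vfield_add oO (smooth_vfield_scale oO sa sX) (smooth_vfield_scale oO sb sY)).
Qed.

Lemma smooth_coefs2 X Y Z : smooth_vfield O X -> smooth_vfield O Y ->
  smooth_vfield O Z ->
  (forall q, O q -> free [:: X q; Y q]) ->
  (forall q, O q -> Z q \in <<[:: X q; Y q]>>%VS) ->
  exists a b, [/\ smooth_fun O a, smooth_fun O b &
    forall q, O q -> Z q = a q *: X q + b q *: Y q].
Proof.
move=> sX sY sZ fr sp; pose F := tnth [tuple X; Y].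
have sF i : smooth_vfield O (F i) by exact: smooth_tuple2.
have frF q : O q -> free (frame_at F q) by move=> Oq; rewrite frame2; exact: fr.
have spF q : O q -> Z q \in <<frame_at F q>>%VS by move=> Oq; rewrite frame2; exact: sp.
exists (fun q => coord (frame_at F q) ord0 (Z q)).
exists (fun q => coord (frame_at F q) (lift ord0 ord0) (Z q)).
split; try exact: smooth_coord_frame.
move=> q Oq; rewrite [LHS](coord_span (spF q Oq)) !big_ord_recl big_ord0 addr0.
by rewrite !frame_atE.
Qed.

Lemma smooth_coefs3 X Y Z T : smooth_vfield O X -> smooth_vfield O Y ->
  smooth_vfield O Z -> smooth_vfield O T ->
  (forall q, O q -> free [:: X q; Y q; Z q]) ->
  (forall q, O q -> T q \in <<[:: X q; Y q; Z q]>>%VS) ->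
  exists a b c, [/\ smooth_fun O a, smooth_fun O b, smooth_fun O c &
    forall q, O q -> T q = a q *: X q + b q *: Y q + c q *: Z q].
Proof.
move=> sX sY sZ sT fr sp; pose F := tnth [tuple X; Y; Z].
have sF i : smooth_vfield O (F i) by exact: smooth_tuple3.
have frF q : O q -> free (frame_at F q) by move=> Oq; rewrite frame3; exact: fr.
have spF q : O q -> T q \in <<frame_at F q>>%VS by move=> Oq; rewrite frame3; exact: sp.
exists (fun q => coord (frame_at F q) ord0 (T q)).
exists (fun q => coord (frame_at F q) (lift ord0 ord0) (T q)).
exists (fun q => coord (frame_at F q) (lift ord0 (lift ord0 ord0)) (T q)).
split; try exact: smooth_coord_frame.
move=> q Oq; rewrite [LHS](coord_span (spF q Oq)) !big_ord_recl big_ord0 addr0.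
by rewrite !frame_atE addrA.
Qed.

Lemma lie_comb2_r X a b Y Z p : smooth_vfield O X -> smooth_fun O a ->
  smooth_fun O b -> smooth_vfield O Y -> smooth_vfield O Z -> O p ->
  lie X (fun q => a q *: Y q + b q *: Z q) p =
  a p *: lie X Y p + dir X a p *: Y p + (b p *: lie X Z p + dir X b p *: Z p).
Proof.
move=> sX sa sb sY sZ Op.
have sP := smooth_vfield_scale oO sa sY; have sQ := smooth_vfield_scale oO sb sZ.
apply: etrans (lie_add_r oO sX sP sQ Op) _.
exact: congr2 (lie_scale_r oO sX sa sY Op) (lie_scale_r oO sX sb sZ Op).
Qed.

Lemma lie_comb2_l X a b Y Z p : smooth_vfield O X -> smooth_fun O a ->
  smooth_fun O b -> smooth_vfield O Y -> smooth_vfield O Z -> O p ->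
  lie (fun q => a q *: Y q + b q *: Z q) X p =
  a p *: lie Y X p - dir X a p *: Y p + (b p *: lie Z X p - dir X b p *: Z p).
Proof.
move=> sX sa sb sY sZ Op.
have sP := smooth_vfield_scale oO sa sY; have sQ := smooth_vfield_scale oO sb sZ.
apply: etrans (lie_add_l oO sX sP sQ Op) _.
exact: congr2 (lie_scale_l oO sX sa sY Op) (lie_scale_l oO sX sb sZ Op).
Qed.

Section Frame2.
Variables (X Y : vfield M) (a b c d : M -> R).
Hypotheses (sX : smooth_vfield O X) (sY : smooth_vfield O Y).
Hypotheses (sa : smooth_fun O a) (sb : smooth_fun O b).
Hypotheses (sc : smooth_fun O c) (sd : smooth_fun O d).
Let U : vfield M := fun q => a q *: X q + b q *: Y q.
Let V : vfield M := fun q => c q *: X q + d q *: Y q.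
Let sU : smooth_vfield O U. Proof. exact: smooth_vfield_comb2. Qed.

(** Modulo X and Y only the determinant of the change of frame survives. The smoothness of e1 and e2
    is recorded because [U, V] is to be bracketed again. *)
Lemma lie_change2 : exists e1 e2, [/\ smooth_fun O e1, smooth_fun O e2 &
  forall q, O q -> lie U V q =
    e1 q *: X q + e2 q *: Y q + (a q * d q - b q * c q) *: lie X Y q].
Proof.
(* From [U, V] = U(c) X + U(d) Y + c [U, X] + d [U, Y], where [U, X] = - b [X, Y] - X(a) X - X(b) Y
   and [U, Y] = a [X, Y] - Y(a) X - Y(b) Y. *)
exists (fun q => dir U c q - c q * dir X a q - d q * dir Y a q).
exists (fun q => dir U d q - c q * dir X b q - d q * dir Y b q).
have sD Z f : smooth_vfield O Z -> smooth_fun O f -> smooth_fun O (dir Z f).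
  exact: smooth_dir.
have sE Z f k l : smooth_vfield O Z -> smooth_fun O f -> smooth_fun O k ->
    smooth_fun O l ->
    smooth_fun O (fun q => dir Z f q - c q * dir X k q - d q * dir Y l q).
  move=> sZ sf sk sl.
  have s1 := smooth_mul oO sc (sD _ _ sX sk).
  have s2 := smooth_mul oO sd (sD _ _ sY sl).
  exact: smooth_sub oO (smooth_sub oO (sD _ _ sZ sf) s1) s2.
split; [exact: sE|exact: sE|].
move=> q Oq; apply: etrans (lie_comb2_r sU sc sd sX sY Oq) _.
have alg (u v w m1 m2 : 'rV[R]_n) (A B C D : R) (uc ud xa xb ya yb : R) :
  m1 = A *: (0 : 'rV[R]_n) - xa *: u + (B *: (- w) - xb *: v) ->
  m2 = A *: w - ya *: u + (B *: (0 : 'rV[R]_n) - yb *: v) ->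
  C *: m1 + uc *: u + (D *: m2 + ud *: v) =
  (uc - C * xa - D * ya) *: u + (ud - C * xb - D * yb) *: v + (A * D - B * C) *: w.
  by move=> -> ->; apply/rowP => j; rewrite !mxE; ring.
apply: alg.
  apply: etrans (lie_comb2_l sX sa sb sX sY Oq) _.
  by rewrite liexx (lieC Y X).
by apply: etrans (lie_comb2_l sY sa sb sX sY Oq) _; rewrite liexx.
Qed.

(** Modulo X, Y and [X, Y] no derivative of a coefficient survives, and the result is bilinear in
    (a, b) and f3. The remaining coefficients are only wanted at the single point q. *)
Lemma lie_change3 f1 f2 f3 q : smooth_fun O f1 -> smooth_fun O f2 ->
  smooth_fun O f3 -> O q ->
  exists e1 e2 e3,
  lie U (fun q => f1 q *: X q + f2 q *: Y q + f3 q *: lie X Y q) q =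
    e1 *: X q + e2 *: Y q + e3 *: lie X Y q +
    f3 q *: (a q *: lie X (lie X Y) q + b q *: lie Y (lie X Y) q).
Proof.
move=> s1 s2 s3 Oq.
have sL := smooth_lie oO sX sY.
have sC := smooth_vfield_comb2 s1 s2 sX sY.
have s3L := smooth_vfield_scale oO s3 sL.
have E1 := lie_add_r oO sU sC s3L Oq.
have E2 := lie_comb2_r sU s1 s2 sX sY Oq.
have E3 := lie_scale_r oO sU s3 sL Oq.
have E4 := lie_comb2_l sL sa sb sX sY Oq.
have E5 := lie_comb2_l sX sa sb sX sY Oq.
have E6 := lie_comb2_l sY sa sb sX sY Oq.
rewrite liexx (lieC Y X) in E5; rewrite liexx in E6.
have alg (t u v w m1 m2 m3 z1 z2 t1 t2 : 'rV[R]_n) (A B F1 F2 F3 p1 p2 p3 xa xb ya yb la lb : R) :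
  t = t1 + t2 ->
  t1 = F1 *: m1 + p1 *: u + (F2 *: m2 + p2 *: v) ->
  t2 = F3 *: m3 + p3 *: w ->
  m3 = A *: z1 - la *: u + (B *: z2 - lb *: v) ->
  m1 = A *: (0 : 'rV[R]_n) - xa *: u + (B *: (- w) - xb *: v) ->
  m2 = A *: w - ya *: u + (B *: (0 : 'rV[R]_n) - yb *: v) ->
  t = (p1 - F1 * xa - F2 * ya - F3 * la) *: u +
      (p2 - F1 * xb - F2 * yb - F3 * lb) *: v +
      (p3 + F2 * A - F1 * B) *: w + F3 *: (A *: z1 + B *: z2).
  by move=> -> -> -> -> -> ->; apply/rowP => j; rewrite !mxE; ring.
by eexists; eexists; eexists;
  exact: (alg _ _ _ _ _ _ _ _ _ _ _ _ _ _ _ _ _ _ _ _ _ _ _ _ _ E1 E2 E3 E4 E5 E6).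
Qed.

End Frame2.
End On.
End Combinations.

(** * The derived flag *)

(** Either minimality applies, or [vspan] takes its default value, the zero subspace. *)
Lemma vspan_sub (R : realType) n (A : set 'rV[R]_n) (W : {vspace 'rV[R]_n}) :
  (forall v, A v -> v \in W) -> (vspan A <= W)%VS.
Proof. by rewrite /vspan => AW; case: xgetP => [V _ [_]|_]; [exact|exact: sub0v]. Qed.

Section DerivedFlag.
Context {R : realType} {n : nat} {M : manifold R n}.
Variable D : tdistribution M.
Variable O : set M.
Hypothesis oO : open O.
Variables X Y : vfield M.
Hypotheses (sX : smooth_vfield O X) (sY : smooth_vfield O Y).
Hypothesis bD : forall q, O q -> basis_of (D q) [tuple X q; Y q].

Let frXY q : O q -> free [:: X q; Y q].
Proof. by move=> /bD /basis_free. Qed.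

Let spanD q : O q -> <<[:: X q; Y q]>>%VS = D q.
Proof. by move=> /bD /span_basis. Qed.

Lemma section_comb2 U Z p : open U -> O p -> U p -> section U D Z ->
  exists a b, [/\ smooth_fun (O `&` U) a, smooth_fun (O `&` U) b &
    forall q, (O `&` U) q -> Z q = a q *: X q + b q *: Y q].
Proof.
move=> oU Op Up [sZ DZ]; apply: smooth_coefs2; first exact: openI.
- by apply: smooth_vfield_sub sX => q [].
- by apply: smooth_vfield_sub sY => q [].
- by apply: smooth_vfield_sub sZ => q [].
- by move=> q [/frXY].
- by move=> q [Oq Uq]; rewrite spanD //; exact: DZ.
Qed.

(** Only the inclusion of the derived distribution in the span is computed. The assumed dimension 3
    turns it into an equality and makes the three generators independent. *)
Lemma derived_span (q : M) : O q -> \dim (dist_bracket D D q) = 3%N ->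
  dist_bracket D D q = <<[:: X q; Y q; lie X Y q]>>%VS /\
  free [:: X q; Y q; lie X Y q].
Proof.
move=> Oq dim3.
have sub : (dist_bracket D D q <= <<[:: X q; Y q; lie X Y q]>>)%VS.
  apply: vspan_sub => _ [U [Z [W [oU Uq secZ secW ->]]]].
  have [a [b [sa sb EZ]]] := section_comb2 oU Oq Uq secZ.
  have [c [d [sc sd EW]]] := section_comb2 oU Oq Uq secW.
  have oV : open (O `&` U) by exact: openI.
  have Vq : (O `&` U) q by split.
  rewrite (lie_loc oV Vq EZ EW).
  have sX' : smooth_vfield (O `&` U) X by apply: smooth_vfield_sub sX => ? [].
  have sY' : smooth_vfield (O `&` U) Y by apply: smooth_vfield_sub sY => ? [].
  have [e1 [e2 [_ _ ->]]] := lie_change2 oV sX' sY' sa sb sc sd; last by [].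
  by apply/span3P; eexists; eexists; eexists.
have dim_le : (\dim <<[:: X q; Y q; lie X Y q]>> <= 3)%N by exact: dim_span.
have E : dist_bracket D D q = <<[:: X q; Y q; lie X Y q]>>%VS.
  by apply/eqP; rewrite eqEdim sub dim3.
by split=> //; rewrite /free -E dim3.
Qed.

(** If both brackets lay in [D, D], then by [lie_change3] so would every bracket of a section of D
    with one of [D, D]. The rank is 3 on all of O so that sections of [D, D] have smooth
    coefficients near p. *)
Lemma second_derived_span (p : M) : O p ->
  (forall q, O q -> \dim (dist_bracket D D q) = 3%N) ->
  (3 < \dim (dist_bracket D (dist_bracket D D) p))%N ->
  ~ (lie X (lie X Y) p \in dist_bracket D D p /\
     lie Y (lie X Y) p \in dist_bracket D D p).
Proof.
move=> Op dim3 dim4 [inX inY]; move: dim4; rewrite ltnNge => /negP; apply.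
rewrite -(dim3 p Op); apply: dimvS; apply: vspan_sub => _ [U [Z [W [oU Up secZ [sW DW] ->]]]].
have [a [b [sa sb EZ]]] := section_comb2 oU Op Up secZ.
have oV : open (O `&` U) by exact: openI.
have Vp : (O `&` U) p by split.
have sX' : smooth_vfield (O `&` U) X by apply: smooth_vfield_sub sX => ? [].
have sY' : smooth_vfield (O `&` U) Y by apply: smooth_vfield_sub sY => ? [].
have sW' : smooth_vfield (O `&` U) W by apply: smooth_vfield_sub sW => ? [].
have sL' := smooth_lie oV sX' sY'.
have fr3 q : (O `&` U) q -> free [:: X q; Y q; lie X Y q].
  by move=> [Oq _]; have [] := derived_span Oq (dim3 q Oq).
have W3 q : (O `&` U) q -> W q \in <<[:: X q; Y q; lie X Y q]>>%VS.
  by move=> [Oq Uq]; have [<- _] := derived_span Oq (dim3 q Oq); exact: DW.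
have [f1 [f2 [f3 [s1 s2 s3 EW]]]] := smooth_coefs3 oV sX' sY' sL' sW' fr3 W3.
rewrite (lie_loc oV Vp EZ EW).
have [e1 [e2 [e3 ->]]] := lie_change3 oV sX' sY' sa sb s1 s2 s3 Vp.
have [Ep _] := derived_span Op (dim3 p Op).
rewrite Ep in inX inY *.
apply: memvD; first by apply/span3P; eexists; eexists; eexists.
exact (memvZ _ (memvD (memvZ _ inX) (memvZ _ inY))).
Qed.

End DerivedFlag.

(** * Determinants of coordinates *)

Section Determinants.
Context {K : comNzRingType}.
Implicit Type f : nat -> nat -> K.

(** Entries are given by a function of natural numbers, so a minor is again a matrix of this form
    and the expansion can be iterated. *)
Let minor0 k f j : row' ord0 (col' j (\matrix_(i < k.+1, j < k.+1) f i j)) =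
  \matrix_(i < k, l < k) f i.+1 (bump j l).
Proof. by apply/matrixP => i l; rewrite !mxE. Qed.

Let det_row0 k f : \det (\matrix_(i < k.+1, j < k.+1) f i j) =
  \sum_(j < k.+1) f 0%N j * ((-1) ^+ j * \det (\matrix_(i < k, l < k) f i.+1 (bump j l))).
Proof.
rewrite (expand_det_row _ ord0); apply: eq_bigr => j _.
by rewrite mxE /cofactor minor0 add0n.
Qed.

Lemma det2 f : \det (\matrix_(i < 2, j < 2) f i j) =
  f 0 0 * f 1 1 - f 0 1 * f 1 0.
Proof.
rewrite det_row0 !big_ord_recl big_ord0 !det_mx11 !mxE /=; ring.
Qed.

Lemma det3 f : \det (\matrix_(i < 3, j < 3) f i j) =
  f 0 0 * (f 1 1 * f 2 2 - f 1 2 * f 2 1)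
  - f 0 1 * (f 1 0 * f 2 2 - f 1 2 * f 2 0)
  + f 0 2 * (f 1 0 * f 2 1 - f 1 1 * f 2 0).
Proof.
rewrite det_row0 !big_ord_recl big_ord0.
rewrite !(det2 (fun i l => f i.+1 (bump _ l))) /=; ring.
Qed.

Lemma det4 f : \det (\matrix_(i < 4, j < 4) f i j) =
  f 0 0 * (f 1 1 * (f 2 2 * f 3 3 - f 2 3 * f 3 2)
           - f 1 2 * (f 2 1 * f 3 3 - f 2 3 * f 3 1)
           + f 1 3 * (f 2 1 * f 3 2 - f 2 2 * f 3 1))
  - f 0 1 * (f 1 0 * (f 2 2 * f 3 3 - f 2 3 * f 3 2)
             - f 1 2 * (f 2 0 * f 3 3 - f 2 3 * f 3 0)
             + f 1 3 * (f 2 0 * f 3 2 - f 2 2 * f 3 0))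
  + f 0 2 * (f 1 0 * (f 2 1 * f 3 3 - f 2 3 * f 3 1)
             - f 1 1 * (f 2 0 * f 3 3 - f 2 3 * f 3 0)
             + f 1 3 * (f 2 0 * f 3 1 - f 2 1 * f 3 0))
  - f 0 3 * (f 1 0 * (f 2 1 * f 3 2 - f 2 2 * f 3 1)
             - f 1 1 * (f 2 0 * f 3 2 - f 2 2 * f 3 0)
             + f 1 2 * (f 2 0 * f 3 1 - f 2 1 * f 3 0)).
Proof.
rewrite det_row0 !big_ord_recl big_ord0.
rewrite !(det3 (fun i l => f i.+1 (bump _ l))) /=; ring.
Qed.

End Determinants.

Section CoordinateDeterminant.
Context {K : fieldType} {V : vectType K}.

Definition det_coord k (B b : k.-tuple V) : K :=
  \det (\matrix_(i, j) coord B j (tnth b i)).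

Lemma det_coord_neq0 k (E : {vspace V}) (B b : k.-tuple V) :
  basis_of E B -> {subset b <= E} -> (det_coord B b != 0) = basis_of E b.
Proof.
move=> bB bE; set C := \matrix_(i, j) coord B j (tnth b i).
have bi i : tnth b i \in E by apply: bE; exact: mem_tnth.
have bC i : tnth b i = \sum_j C i j *: B`_j.
  by rewrite [LHS](coord_basis bB (bi i)); apply: eq_bigr => j _; rewrite mxE.
have comb (u : 'I_k -> K) : \sum_i u i *: b`_i = \sum_j (\sum_i u i * C i j) *: B`_j.
  under eq_bigr => i _ do rewrite -tnth_nth bC scaler_sumr.
  rewrite exchange_big; apply: eq_bigr => j _.
  by rewrite scaler_suml; apply: eq_bigr => i _; rewrite scalerA.
apply/idP/idP => [dC|bb].
  have fb : free b.
    apply/freeP => u; rewrite comb => /(elimT freeP (basis_free bB)) uC i.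
    have : (\row_i u i) *m C = 0.
      by apply/rowP => j; rewrite !mxE -[RHS](uC j); apply: eq_bigr => l _; rewrite mxE.
    move=> /(congr1 (fun A => A *m \adj C)); rewrite -mulmxA mul_mx_adj mul0mx.
    rewrite mul_mx_scalar => /rowP /(_ i); rewrite !mxE => /eqP.
    by rewrite mulf_eq0 (negPf dC) /= => /eqP.
  rewrite basisEfree fb size_tuple (size_basis bB) leqnn andbT.
  by apply/span_subvP.
apply/negP => /eqP /eqP /det0P[u u0 uC]; move: u0; apply/negP/negPn/eqP.
apply/rowP => i; rewrite [RHS]mxE.
apply: (elimT freeP (basis_free bb) (u 0)); rewrite comb big1 // => j _.
by move/rowP/(_ j): uC; rewrite !mxE => ->; rewrite scale0r.
Qed.

(** The matrix of [det_coord] with natural number indices, as [det2] and [det4] expect. *)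
Let entry k (B b : k.+1.-tuple V) (i j : nat) : K := coord B (inord j) b`_i.

Let det_coordE k (B b : k.+1.-tuple V) : det_coord B b =
  \det (\matrix_(i < k.+1, j < k.+1) entry B b i j).
Proof.
rewrite /det_coord; congr (\det _); apply/matrixP => i j.
by rewrite !mxE (tnth_nth 0) /entry inord_val.
Qed.

Lemma det_coord_id k (E : {vspace V}) (B : k.-tuple V) : basis_of E B -> det_coord B B = 1.
Proof.
move=> bB; rewrite /det_coord [X in \det X](_ : _ = 1%:M) ?det1 //.
by apply/matrixP => i j; rewrite !mxE (tnth_nth 0) coord_free ?(basis_free bB) // eq_sym.
Qed.

Lemma det_coord_comb2 (B : 2.-tuple V) (u v : V) (a b c d : K) :
  det_coord B [tuple a *: u + b *: v; c *: u + d *: v] =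
  (a * d - b * c) * det_coord B [tuple u; v].
Proof.
rewrite !det_coordE !det2 /entry /= !linearD !linearZ /=; ring.
Qed.

(* The last two vectors model [X_1, X_2] and [X_1, [X_1, X_2]] for the frame
   X_1 = a u + b v, X_2 = c u + d v, where w = [u, v], y = [u, w], z = [v, w]. *)
Lemma det_coord_flag (B : 4.-tuple V) (u v w y z : V)
    (a b c d e1 e2 f1 f2 f3 : K) :
  let dl := a * d - b * c in
  det_coord B [tuple a *: u + b *: v; c *: u + d *: v; e1 *: u + e2 *: v + dl *: w;
     f1 *: u + f2 *: v + f3 *: w + dl *: (a *: y + b *: z)] =
  dl ^+ 3 * (a * det_coord B [tuple u; v; w; y] + b * det_coord B [tuple u; v; w; z]).
Proof.
move=> dl.
(* Only the factor produced by the first two vectors has to be expanded. The other two are the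
   scalars visible in the third and fourth vectors, and dl is generalized to an arbitrary scalar
   there. *)
have -> : dl ^+ 3 = (a * d - b * c) * dl * dl by rewrite /dl; ring.
have lin2 j (r s : K) (x t : V) :
    coord B j (r *: x + s *: t) = r * coord B j x + s * coord B j t.
  by rewrite linearD !linearZ.
have lin3 j (r s l : K) (x t o : V) : coord B j (r *: x + s *: t + l *: o) =
    r * coord B j x + s * coord B j t + l * coord B j o.
  by rewrite !linearD !linearZ.
have lin4 j (r s l m : K) (x t o k : V) : coord B j (r *: x + s *: t + l *: o + m *: k) =
    r * coord B j x + s * coord B j t + l * coord B j o + m * coord B j k.
  by rewrite !linearD !linearZ.
move: dl => dl; rewrite !det_coordE !det4 /entry /= !lin4 !lin3 !lin2; ring.
Qed.

Lemma det_coord_last (B : 4.-tuple V) (u v w y z : V) (c d : K) :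
  det_coord B [tuple u; v; w; c *: y + d *: z] =
  c * det_coord B [tuple u; v; w; y] + d * det_coord B [tuple u; v; w; z].
Proof.
have lin2 j : coord B j (c *: y + d *: z) = c * coord B j y + d * coord B j z.
  by rewrite linearD !linearZ.
rewrite !det_coordE !det4 /entry /= !lin2; ring.
Qed.

End CoordinateDeterminant.

(** * Adapted frames *)

Section Orientation.
Context {R : realType} {n : nat} {M : manifold R n}.

(** The vectors of b' are only known to lie in E p: a positive determinant already makes them a
    basis. *)
Lemma oriented_det k (E : tdistribution M) (o : M -> k.-tuple 'rV[R]_n -> Prop)
    p (b b' : k.-tuple 'rV[R]_n) :
  orientation E o -> o p b -> {subset b' <= E p} -> o p b' <-> 0 < det_coord b b'.
Proof.
move=> [ob odet _] opb b'E; split=> [ob'|dp].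
  by have [H _] := odet p b b' opb (ob p b' ob'); exact: H.
have b'b : basis_of (E p) b'.
  by rewrite -(det_coord_neq0 (ob p b opb) b'E) gt_eqF.
by have [_ H] := odet p b b' opb b'b; exact: H.
Qed.

End Orientation.

Section Metric.
Context {R : realType} {n : nat} {M : manifold R n}.
Variables (D : tdistribution M) (g : M -> 'rV[R]_n -> 'rV[R]_n -> R).
Hypothesis mg : metric_on D g.
Implicit Types (p : M) (u v w : 'rV[R]_n) (a b c d : R).

Lemma metricC p u v : u \in D p -> v \in D p -> g p u v = g p v u.
Proof. by case: mg => H _ _ _; exact: H. Qed.

Lemma metric_gt0 p u : u \in D p -> u != 0 -> 0 < g p u u.
Proof. by case: mg => _ _ H _; exact: H. Qed.

Lemma metricDZl p a u v w : u \in D p -> v \in D p -> w \in D p ->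
  g p (a *: u + v) w = a * g p u w + g p v w.
Proof. by case: mg => _ H _ _; exact: H. Qed.

Lemma metric0l p w : w \in D p -> g p 0 w = 0.
Proof.
move=> wD; have D0 := mem0v (D p).
have := metricDZl 1 D0 D0 wD; rewrite scale1r addr0 mul1r.
by move=> /(congr1 (fun x => x - g p 0 w)); rewrite subrr addrK.
Qed.

Lemma metricZl p a u w : u \in D p -> w \in D p -> g p (a *: u) w = a * g p u w.
Proof.
move=> uD wD; have := metricDZl a uD (mem0v (D p)) wD.
by rewrite addr0 metric0l // addr0.
Qed.

Lemma metricZr p a u w : u \in D p -> w \in D p -> g p w (a *: u) = a * g p w u.
Proof.
by move=> uD wD; rewrite metricC ?memvZ // metricZl // metricC.
Qed.

Lemma metric_comb2l p a b u v w : u \in D p -> v \in D p -> w \in D p ->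
  g p (a *: u + b *: v) w = a * g p u w + b * g p v w.
Proof. by move=> uD vD wD; rewrite metricDZl ?memvZ // metricZl. Qed.

Lemma metric_comb2 p a b c d u v : u \in D p -> v \in D p ->
  g p u u = 1 -> g p v v = 1 -> g p u v = 0 ->
  g p (a *: u + b *: v) (c *: u + d *: v) = a * c + b * d.
Proof.
move=> uD vD g11 g22 g12.
have wD : c *: u + d *: v \in D p by apply: memvD; exact: memvZ.
rewrite metric_comb2l // metricC // metric_comb2l //.
rewrite [X in _ + b * X]metricC // metric_comb2l // g11 g22 [g p v u]metricC // g12.
ring.
Qed.

Lemma smooth_metric O (X Y : vfield M) : open O -> section O D X -> section O D Y ->
  smooth_fun O (fun q => g q (X q) (Y q)).
Proof. by case: mg => _ _ _; exact. Qed.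

End Metric.

Section FrameChange.
Context {R : realType} {M : manifold R 4}.

(** The frame generated by its first two fields; the canonical frame is encoded by this pair. *)
Definition flag (X Y : vfield M) p : 4.-tuple 'rV[R]_4 :=
  [tuple X p; Y p; lie X Y p; lie X (lie X Y) p].

Variables (O : set M) (X Y : vfield M) (a b c d : M -> R).
Hypotheses (oO : open O) (sX : smooth_vfield O X) (sY : smooth_vfield O Y).
Hypotheses (sa : smooth_fun O a) (sb : smooth_fun O b).
Hypotheses (sc : smooth_fun O c) (sd : smooth_fun O d).
Let U : vfield M := fun q => a q *: X q + b q *: Y q.
Let V : vfield M := fun q => c q *: X q + d q *: Y q.
Let dl q := a q * d q - b q * c q.

(** The first part turns the condition on [V, [U, V]] into a linear equation for (c, d); the second
    turns the orientation of M into a sign condition on (a, b). *)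
Lemma flag_change q : O q ->
  (exists e1 e2 e3, lie V (lie U V) q = e1 *: X q + e2 *: Y q + e3 *: lie X Y q +
     dl q *: (c q *: lie X (lie X Y) q + d q *: lie Y (lie X Y) q)) /\
  forall B, det_coord B (flag U V q) = dl q ^+ 3 *
    (a q * det_coord B (flag X Y q) +
     b q * det_coord B [tuple X q; Y q; lie X Y q; lie Y (lie X Y) q]).
Proof.
move=> Oq.
have [e1 [e2 [s1 s2 E]]] := lie_change2 oO sX sY sa sb sc sd.
have s3 : smooth_fun O dl by apply: smooth_sub => //; exact: smooth_mul.
split.
  have [f1 [f2 [f3 E3]]] := lie_change3 oO sX sY sc sd s1 s2 s3 Oq.
  exists f1, f2, f3; apply: etrans E3; exact: (lie_loc oO Oq (fun _ _ => erefl) E).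
have [f1 [f2 [f3 E3]]] := lie_change3 oO sX sY sa sb s1 s2 s3 Oq.
move=> B.
have E4 : lie U (lie U V) q = _ := etrans (lie_loc oO Oq (fun _ _ => erefl) E) E3.
have -> : flag U V q = [tuple U q; V q;
   e1 q *: X q + e2 q *: Y q + (a q * d q - b q * c q) *: lie X Y q;
   f1 *: X q + f2 *: Y q + f3 *: lie X Y q + (a q * d q - b q * c q) *:
     (a q *: lie X (lie X Y) q + b q *: lie Y (lie X Y) q)].
  by apply/val_inj; rewrite /= E4 (E q Oq).
exact: det_coord_flag.
Qed.

End FrameChange.

(** Modulo S only l c y is left. It is applied with S = [D, D], y = [X, [X, Y]] and z = [Y,
    [X, Y]]. *)
Lemma coef_eq0 (K : fieldType) (V : vectType K) (S : {vspace V}) (x y z : V) (l c d : K) :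
  x \in S -> x + l *: (c *: y + d *: z) \in S -> z \in S -> l != 0 -> y \notin S ->
  c = 0.
Proof.
move=> xS H zS l0; apply: contraNeq => c0.
have H1 : l *: (c *: y + d *: z) \in S.
  by have := memvB H xS; rewrite addrAC subrr add0r.
have H2 : c *: y + d *: z \in S by have := memvZ l^-1 H1; rewrite scalerK.
have H3 : c *: y \in S by have := memvB H2 (memvZ d zS); rewrite addrK.
by have := memvZ c^-1 H3; rewrite scalerK.
Qed.

Lemma free_last (K : fieldType) (V : vectType K) (s : seq V) v :
  free (s ++ [:: v]) -> v \notin span s.
Proof. by rewrite (perm_free (permEl (perm_catC s [:: v]))) free_cons => /andP[]. Qed.

Lemma tuple4_eq (T : Type) (a b c d a' b' c' d' : T) : a = a' -> b = b' -> c = c' ->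
  d = d' -> [tuple a; b; c; d] = [tuple a'; b'; c'; d'].
Proof. by move=> -> -> -> ->. Qed.

Section AdaptedFrames.
Context {R : realType} {M : manifold R 4}.
Variables (D : tdistribution M) (g : M -> 'rV[R]_4 -> 'rV[R]_4 -> R).
Variables (oM : M -> 4.-tuple 'rV[R]_4 -> Prop) (oD : M -> 2.-tuple 'rV[R]_4 -> Prop).
Hypothesis engelD : engel D g.
Hypothesis orM : orientation (fun=> fullv) oM.
Hypothesis orD : orientation D oD.
Implicit Types (O : set M) (X Y Z : vfield M) (p : M).

(** A local form of [canonical_frame] with X3 and X4 eliminated, so that frames can be built,
    compared and glued on open sets. *)
Definition adapted O X Y : Prop :=
  [/\ smooth_vfield O X /\ smooth_vfield O Y,
      forall p, O p -> [/\ X p \in D p, Y p \in D p, g p (X p) (X p) = 1,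
                           g p (Y p) (Y p) = 1 & g p (X p) (Y p) = 0],
      forall p, O p -> lie Y (lie X Y) p \in <<[:: X p; Y p; lie X Y p]>>%VS,
      forall p, O p -> oM p (flag X Y p) &
      forall p, O p -> oD p [tuple X p; Y p]].

Let mg : metric_on D g. Proof. by case: engelD. Qed.

Let dim3 (p : M) : \dim (dist_bracket D D p) = 3%N.
Proof. by case: engelD => _ H _ _; exact: H. Qed.

Let dim4 (p : M) : \dim (dist_bracket D (dist_bracket D D) p) = 4%N.
Proof. by case: engelD => _ _ H _; exact: H. Qed.

Lemma adapted_sub O U X Y : U `<=` O -> adapted O X Y -> adapted U X Y.
Proof.
move=> UO [[sX sY] H1 H2 H3 H4]; split.
- by split; [exact: smooth_vfield_sub UO sX|exact: smooth_vfield_sub UO sY].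
- by move=> p /UO; exact: H1.
- by move=> p /UO; exact: H2.
- by move=> p /UO; exact: H3.
- by move=> p /UO; exact: H4.
Qed.

Lemma adapted_congr O X Y X' Y' : open O -> (forall p, O p -> X p = X' p) ->
  (forall p, O p -> Y p = Y' p) -> adapted O X Y -> adapted O X' Y'.
Proof.
move=> oO XX YY [[sX sY] H1 H2 H3 H4].
have L p : O p -> lie X Y p = lie X' Y' p by move=> Op; exact: (lie_loc oO Op XX YY).
have LX p : O p -> lie X (lie X Y) p = lie X' (lie X' Y') p.
  by move=> Op; exact: (lie_loc oO Op XX L).
have LY p : O p -> lie Y (lie X Y) p = lie Y' (lie X' Y') p.
  by move=> Op; exact: (lie_loc oO Op YY L).
split.
- by split; [exact: smooth_vfield_congr oO XX sX|exact: smooth_vfield_congr oO YY sY].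
- by move=> p Op; rewrite -XX // -YY //; exact: H1.
- by move=> p Op; have := H2 p Op; rewrite (LY p Op) (L p Op) (XX p Op) (YY p Op).
- move=> p Op; have <- : flag X Y p = flag X' Y' p; last exact: H3.
  by apply/val_inj; rewrite /= (LX p Op) (L p Op) (XX p Op) (YY p Op).
- move=> p Op; have <- : [tuple X p; Y p] = [tuple X' p; Y' p]; last exact: H4.
  by apply/val_inj; rewrite /= (XX p Op) (YY p Op).
Qed.

Lemma adapted_local O X Y :
  (forall p, O p -> exists U, [/\ open U, U p & adapted U X Y]) -> adapted O X Y.
Proof.
move=> H; split.
- split; apply: smooth_vfield_local => p /H[U [oU Up [[sX sY] _ _ _ _]]].
    by exists U.
  by exists U.
- by move=> p /H[U [oU Up [_ H1 _ _ _]]]; exact: H1.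
- by move=> p /H[U [oU Up [_ _ H1 _ _]]]; exact: H1.
- by move=> p /H[U [oU Up [_ _ _ H1 _]]]; exact: H1.
- by move=> p /H[U [oU Up [_ _ _ _ H1]]]; exact: H1.
Qed.

Lemma adapted_basis O X Y p : adapted O X Y -> O p -> basis_of (D p) [tuple X p; Y p].
Proof. by case: orD => H _ _ [_ _ _ _ oXY] Op; exact/H/oXY. Qed.

Lemma adapted_flag O X Y p : adapted O X Y -> O p -> basis_of fullv (flag X Y p).
Proof. by case: orM => H _ _ [_ _ _ oXY _] Op; apply: (H p); exact: oXY. Qed.

(** With X' = a X + b Y and Y' = c X + d Y, the bracket condition gives c = 0, orthogonality then b
    = 0 and the norms a^2 = d^2 = 1. The orientations give a d > 0 and (a d)^3 a > 0, hence a = d =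
    1. *)
Lemma adapted_unique O X Y X' Y' : open O -> adapted O X Y -> adapted O X' Y' ->
  forall p, O p -> X p = X' p /\ Y p = Y' p.
Proof.
move=> oO aXY aXY' p Op.
have bXY q : O q -> basis_of (D q) [tuple X q; Y q] by exact: adapted_basis.
have bXY' q : O q -> basis_of (D q) [tuple X' q; Y' q] by exact: adapted_basis.
have bF := adapted_flag aXY Op; have bF' := adapted_flag aXY' Op.
move: aXY aXY' => [[sX sY] onXY inXY oMXY oDXY] [[sX' sY'] onXY' inXY' oMXY' oDXY'].
have fr q : O q -> free [:: X q; Y q] by move=> /bXY /basis_free.
have sp q : O q -> <<[:: X q; Y q]>>%VS = D q by move=> /bXY /span_basis.
have XD q : O q -> X' q \in <<[:: X q; Y q]>>%VS.
  by move=> Oq; rewrite sp //; have [] := onXY' q Oq.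
have YD q : O q -> Y' q \in <<[:: X q; Y q]>>%VS.
  by move=> Oq; rewrite sp //; have [] := onXY' q Oq.
have [a [b [sa sb EX]]] := smooth_coefs2 oO sX sY sX' fr XD.
have [c [d [sc sd EY]]] := smooth_coefs2 oO sX sY sY' fr YD.
have [[e1 [e2 [e3 E4]]] detF] := flag_change oO sX sY sa sb sc sd Op.
have EL q : O q -> _ := fun Oq => lie_loc oO Oq EX EY.
have [XDp YDp g11 g22 g12] := onXY p Op.
have [_ _ h11 h22 h12] := onXY' p Op.
rewrite (EX p Op) (EY p Op) !(metric_comb2 mg) // in h11 h22 h12.
have dl_gt0 : 0 < a p * d p - b p * c p.
  have sub : {subset [tuple X' p; Y' p] <= D p}.
    by move=> v; apply: basis_mem; exact: bXY'.
  have /(oriented_det orD (oDXY p Op) sub) := oDXY' p Op.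
  have -> : [tuple X' p; Y' p] =
      [tuple a p *: X p + b p *: Y p; c p *: X p + d p *: Y p].
    by apply/val_inj; rewrite /= EX // EY.
  by rewrite det_coord_comb2 (det_coord_id (bXY p Op)) mulr1.
have [D2 fD2] := derived_span oO sX sY bXY Op (dim3 p).
have [D2' _] := derived_span oO sX' sY' bXY' Op (dim3 p).
(* Both frames span the same [D, D], so the condition on X', Y' can be read in the span of X, Y,
   [X, Y], to which [X, [X, Y]] is transverse. *)
have c0 : c p = 0.
  have in4 : lie Y' (lie X' Y') p \in <<[:: X p; Y p; lie X Y p]>>%VS.
    by rewrite -D2 D2'; exact: inXY'.
  rewrite (lie_loc oO Op EY EL) E4 in in4.
  have inE : e1 *: X p + e2 *: Y p + e3 *: lie X Y p \in <<[:: X p; Y p; lie X Y p]>>%VS.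
    by apply/span3P; exists e1, e2, e3.
  apply: coef_eq0 inE in4 (inXY p Op) _ _; first by rewrite gt_eqF.
  exact: (@free_last _ _ [:: X p; Y p; lie X Y p] _ (basis_free bF)).
have d0 : d p != 0 by apply: contraTneq dl_gt0 => ->; rewrite c0 !mulr0 subrr ltxx.
have b0 : b p = 0.
  by move/eqP: h12; rewrite c0 mulr0 add0r mulf_eq0 (negPf d0) orbF => /eqP.
rewrite b0 c0 !(mulr0, mul0r) ?subr0 ?addr0 ?add0r in dl_gt0 h11 h22.
(* This is the determinant of the new flag in the coordinates of the old one, after b = c = 0. *)
have sign_a : 0 < (a p * d p) ^+ 3 * a p.
  have sub : {subset flag X' Y' p <= (fullv : {vspace 'rV[R]_4})} by move=> v _; exact: memvf.
  have /(oriented_det orM (oMXY p Op) sub) := oMXY' p Op.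
  have -> : flag X' Y' p = flag (fun q => a q *: X q + b q *: Y q)
      (fun q => c q *: X q + d q *: Y q) p.
    exact: tuple4_eq (EX p Op) (EY p Op) (EL p Op) (lie_loc oO Op EX EL).
  have DB := detF (flag X Y p).
  rewrite b0 mul0r subr0 mul0r addr0 in DB.
  have alg (x y l r : R) : x = l * (r * y) -> y = 1 -> 0 < x -> 0 < l * r.
    by move=> -> ->; rewrite mulr1.
  exact: alg DB (det_coord_id bF).
have a_gt0 : 0 < a p by rewrite pmulr_rgt0 ?exprn_gt0 in sign_a.
have d_gt0 : 0 < d p by rewrite pmulr_rgt0 in dl_gt0.
have sq1 (x : R) : 0 < x -> x * x = 1 -> x = 1.
  by move=> x0 /eqP; rewrite -expr2 sqrf_eq1 => /orP[/eqP //|/eqP E]; move: x0; rewrite E ltr0N1.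
rewrite (EX p Op) (EY p Op) (sq1 _ a_gt0 h11) (sq1 _ d_gt0 h22) b0 c0.
by rewrite !scale1r !scale0r add0r addr0.
Qed.

Lemma smooth_det_coord U (W F : 'I_4 -> vfield M) : open U ->
  (forall i, smooth_vfield U (W i)) -> (forall i, smooth_vfield U (F i)) ->
  (forall q, U q -> basis_of fullv (frame_at W q)) ->
  smooth_fun U (fun q => det_coord (frame_at W q) (frame_at F q)).
Proof.
move=> oU sW sF bW; apply: smooth_det => // i j.
apply: (@smooth_fun_congr _ _ _ _ (fun q => coord (frame_at W q) j (F i q))) => //.
  by move=> q _; rewrite mxE tnth_mktuple.
apply: smooth_coord_frame => // q Uq; first exact: basis_free (bW q Uq).
by rewrite (span_basis (bW q Uq)); exact: memvf.
Qed.

Lemma det0_in_span (B : 4.-tuple 'rV[R]_4) (u v w y : 'rV[R]_4) :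
  basis_of fullv B -> free [:: u; v; w] -> det_coord B [tuple u; v; w; y] = 0 ->
  y \in <<[:: u; v; w]>>%VS.
Proof.
move=> bB fr d0; apply: contraPT d0 => yn; apply/eqP.
rewrite (@det_coord_neq0 _ _ _ fullv) //; last by move=> x _; exact: memvf.
rewrite basisEfree; apply/and3P; split; [|exact: subvf|by rewrite dimvf].
suff : free ([:: u; v; w] ++ [:: y]) by [].
by rewrite (perm_free (permEl (perm_catC _ _))) free_cons yn.
Qed.

Lemma free2_neq0 (u v : 'rV[R]_4) a b : free [:: u; v] -> (a != 0) || (b != 0) ->
  a *: u + b *: v != 0.
Proof.
move=> fr; apply: contraTneq => E.
have F := elimT (@freeP _ _ _ [tuple u; v]) fr (tnth [tuple a; b]).
have {}F i : tnth [tuple a; b] i = 0.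
  by apply: F; rewrite !big_ord_recl big_ord0 addr0.
by rewrite negb_or !negbK; apply/andP; split; apply/eqP;
  [exact: (F ord0)|exact: (F (lift ord0 ord0))].
Qed.

Lemma sqrt_normalize (t : R) : 0 < t -> (Num.sqrt t)^-1 * ((Num.sqrt t)^-1 * t) = 1.
Proof.
move=> t0; have s0 : Num.sqrt t != 0 by rewrite gt_eqF // sqrtr_gt0.
by rewrite -[X in _ * (_ * X)](sqr_sqrtr (ltW t0)) expr2 mulKf // mulVf.
Qed.

Lemma oriented_local_frame2 p : exists (O : set M) X Y,
  [/\ open O, O p, smooth_vfield O X, smooth_vfield O Y &
      forall q, O q -> oD q [tuple X q; Y q]].
Proof.
case: orD => _ _ /(_ p)[U [Z [oU Up sZ oZ]]].
exists U, (Z ord0), (Z (lift ord0 ord0)); split=> // q Uq.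
have <- : frame_at Z q = [tuple Z ord0 q; Z (lift ord0 ord0) q]; last exact: oZ.
by apply/val_inj; rewrite /= enum_ordSl enum_ordSl enum_ord0.
Qed.

Section FromCoefficients.
Variables (O : set M) (Z1 Z2 : vfield M) (W : 'I_4 -> vfield M) (a b c d al be : M -> R).
Hypotheses (oO : open O) (s1 : smooth_vfield O Z1) (s2 : smooth_vfield O Z2).
Hypothesis oZ : forall q, O q -> oD q [tuple Z1 q; Z2 q].
Hypothesis oW : forall q, O q -> oM q (frame_at W q).
(** al and be are variables tied to the determinants by equations, which keeps the determinants
    folded in the algebra on coefficients. *)
Hypothesis alE : forall q, al q = det_coord (frame_at W q) (flag Z1 Z2 q).
Hypothesis beE : forall q, be q =
  det_coord (frame_at W q) [tuple Z1 q; Z2 q; lie Z1 Z2 q; lie Z2 (lie Z1 Z2) q].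

Let bZ q : O q -> basis_of (D q) [tuple Z1 q; Z2 q].
Proof. by case: orD => H _ _ Oq; exact/H/oZ. Qed.

Let bW q : O q -> basis_of fullv (frame_at W q).
Proof. by case: orM => H _ _ Oq; apply: (H q); exact: oW. Qed.

Let combD q x y : O q -> x *: Z1 q + y *: Z2 q \in D q.
Proof.
move=> /bZ B; apply: memvD; apply: memvZ; apply: (basis_mem B);
  by rewrite !inE eqxx ?orbT.
Qed.

(** The rank 4 condition enters here: if al and be both vanished at q, both second brackets would
    lie in [D, D], against [second_derived_span]. *)
Lemma flag_components_gt0 q : O q -> 0 < al q * al q + be q * be q.
Proof.
move=> Oq; move: (al q) (be q) (alE q) (beE q) => u v uE vE.
have [E fr3] := derived_span oO s1 s2 bZ Oq (dim3 q).
have d4 : (3 < \dim (dist_bracket D (dist_bracket D D) q))%N by rewrite dim4.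
have not0 : u != 0 \/ v != 0.
  have [u0|] := eqVneq u 0; last by left.
  have [v0|] := eqVneq v 0; last by right.
  case: (second_derived_span oO s1 s2 bZ Oq (fun q _ => dim3 q) d4).
  rewrite E; split; first exact: det0_in_span (bW Oq) fr3 (etrans (esym uE) u0).
  exact: det0_in_span (bW Oq) fr3 (etrans (esym vE) v0).
move: u v not0 {uE vE} => u v [] n0.
  by rewrite ltr_wpDr -?expr2 ?sqr_ge0 // exprn_even_gt0.
by rewrite ltr_wpDl -?expr2 ?sqr_ge0 // exprn_even_gt0.
Qed.

Hypotheses (sa : smooth_fun O a) (sb : smooth_fun O b).
Hypotheses (sc : smooth_fun O c) (sd : smooth_fun O d).
Let X : vfield M := fun q => a q *: Z1 q + b q *: Z2 q.
Let Y : vfield M := fun q => c q *: Z1 q + d q *: Z2 q.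
Hypothesis onXY : forall q, O q ->
  [/\ g q (X q) (X q) = 1, g q (Y q) (Y q) = 1 & g q (X q) (Y q) = 0].
Hypothesis dl_gt0 : forall q, O q -> 0 < a q * d q - b q * c q.
Hypothesis ab_gt0 : forall q, O q -> 0 < a q * al q + b q * be q.
Hypothesis cd0 : forall q, O q -> c q * al q + d q * be q = 0.

Lemma adapted_comb2 : adapted O X Y.
Proof.
have sX : smooth_vfield O X by exact: smooth_vfield_comb2.
have sY : smooth_vfield O Y by exact: smooth_vfield_comb2.
have oXY q : O q -> oD q [tuple X q; Y q].
  move=> Oq; have sub : {subset [tuple X q; Y q] <= D q}.
    by move=> v; rewrite !inE => /orP[] /eqP ->; exact: combD.
  apply/(oriented_det orD (oZ Oq) sub).
  by rewrite det_coord_comb2 (det_coord_id (bZ Oq)) mulr1 dl_gt0.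
have bXY q : O q -> basis_of (D q) [tuple X q; Y q].
  by case: orD => H _ _ Oq; exact/H/oXY.
split=> //.
- by move=> q Oq; have [? ? ?] := onXY Oq; split=> //; exact: combD.
- move=> q Oq; have [[e1 [e2 [e3 E]]] _] := flag_change oO s1 s2 sa sb sc sd Oq.
  have [EZ fr3] := derived_span oO s1 s2 bZ Oq (dim3 q).
  have [EX _] := derived_span oO sX sY bXY Oq (dim3 q).
  (* Both pairs of fields span [D, D] with their bracket, so membership is tested in the span for
     Z1, Z2, where [cd0] makes the transverse component zero. *)
  rewrite -EX EZ E; apply: memvD; first by apply/span3P; exists e1, e2, e3.
  apply: memvZ; apply: det0_in_span (bW Oq) fr3 _.
  apply: etrans (det_coord_last _ _ _ _ _ _ _ _) _.
  by apply: etrans (cd0 Oq); rewrite (alE q) (beE q).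
- move=> q Oq.
  have sub : {subset flag X Y q <= (fullv : {vspace 'rV[R]_4})} by move=> v _; exact: memvf.
  apply/(oriented_det orM (oW Oq) sub).
  have [_ E] := flag_change oO s1 s2 sa sb sc sd Oq.
  have alg (x l r : R) : x = l * r -> 0 < l -> 0 < r -> 0 < x by move=> ->; exact: mulr_gt0.
  apply: alg (E (frame_at W q)) _ _; first by rewrite exprn_gt0 // dl_gt0.
  by have := ab_gt0 Oq; rewrite (alE q) (beE q).
Qed.

(** Used for X2 and, after orthogonalization, for X1. The nested product is what linearity of g in
    each argument yields for the square of the norm. *)
Lemma normalizing_factor x y : smooth_fun O x -> smooth_fun O y ->
  (forall q, O q -> (x q != 0) || (y q != 0)) ->
  exists l, [/\ smooth_fun O l, forall q, O q -> 0 < l q & forall q, O q ->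
    l q * (l q * g q (x q *: Z1 q + y q *: Z2 q) (x q *: Z1 q + y q *: Z2 q)) = 1].
Proof.
move=> sx sy xy0; pose V : vfield M := fun q => x q *: Z1 q + y q *: Z2 q.
have pos q : O q -> 0 < g q (V q) (V q).
  move=> Oq; apply: (metric_gt0 mg); first exact: combD.
  by apply: free2_neq0; [exact: basis_free (bZ Oq)|exact: xy0].
exists (fun q => (Num.sqrt (g q (V q) (V q)))^-1); split.
- apply: smooth_inv => //; first by move=> q Oq; rewrite gt_eqF // sqrtr_gt0 pos.
  apply: smooth_sqrt => //.
  have sec : section O D V.
    by split; [exact: smooth_vfield_comb2|move=> q Oq; exact: combD].
  exact: (smooth_metric mg oO sec sec).
- by move=> q Oq; rewrite invr_gt0 sqrtr_gt0 pos.
- by move=> q Oq; exact: sqrt_normalize (pos q Oq).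
Qed.

End FromCoefficients.

(* Write al, be for the components of [Z1, Z3], [Z2, Z3] transverse to
   span {Z1, Z2, Z3}, where Z3 = [Z1, Z2].  The condition on [X2, X3] forces X2 to
   be a positive multiple of - be Z1 + al Z2 (positivity coming from the two
   orientations), and X1 is then obtained by Gram-Schmidt from al Z1 + be Z2. *)
Lemma adapted_exists p : exists O X Y, [/\ open O, O p & adapted O X Y].
Proof.
have [U1 [W [oU1 U1p sW1 oW1]]] : exists (O : set M) (W : 'I_4 -> vfield M),
  [/\ open O, O p, forall i, smooth_vfield O (W i) & forall q, O q -> oM q (frame_at W q)].
  by case: orM => _ _ H; exact: H.
have [U2 [Z1 [Z2 [oU2 U2p sZ1 sZ2 oZ2]]]] := oriented_local_frame2 p.
pose O := U1 `&` U2.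
have oO : open O by exact: openI.
have sW i : smooth_vfield O (W i) by apply: smooth_vfield_sub (sW1 i) => q [].
have s1 : smooth_vfield O Z1 by apply: smooth_vfield_sub sZ1 => q [].
have s2 : smooth_vfield O Z2 by apply: smooth_vfield_sub sZ2 => q [].
have oZ q : O q -> oD q [tuple Z1 q; Z2 q] by move=> [_]; exact: oZ2.
have oW q : O q -> oM q (frame_at W q) by move=> []; move=> /oW1.
have bZ q : O q -> basis_of (D q) [tuple Z1 q; Z2 q].
  by case: orD => H _ _ Oq; exact/H/oZ.
have bW q : O q -> basis_of fullv (frame_at W q).
  by case: orM => H _ _ Oq; apply: (H q); exact: oW.
have combD q x y : O q -> x *: Z1 q + y *: Z2 q \in D q.
  move=> /bZ B; apply: memvD; apply: memvZ; apply: (basis_mem B);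
  by rewrite !inE eqxx ?orbT.
have s3 : smooth_vfield O (lie Z1 Z2) by exact: smooth_lie.
have sdet T : smooth_vfield O T -> smooth_fun O
    (fun q => det_coord (frame_at W q) [tuple Z1 q; Z2 q; lie Z1 Z2 q; T q]).
  move=> sT; pose F := tnth [tuple Z1; Z2; lie Z1 Z2; T].
  have sF i : smooth_vfield O (F i) by exact: smooth_tuple4.
  apply: smooth_fun_congr (smooth_det_coord oO sW sF bW) => // q _.
  by rewrite frame4.
have [al [sal alE]] : exists al, smooth_fun O al /\
    forall q, al q = det_coord (frame_at W q) (flag Z1 Z2 q).
  eexists; split; first exact: sdet (smooth_lie oO s1 s3).
  by move=> q; exact: erefl.
have [be [sbe beE]] : exists be, smooth_fun O be /\ forall q, be q =
    det_coord (frame_at W q) [tuple Z1 q; Z2 q; lie Z1 Z2 q; lie Z2 (lie Z1 Z2) q].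
  eexists; split; first exact: sdet (smooth_lie oO s2 s3).
  by move=> q; exact: erefl.
have nz q : O q -> 0 < al q * al q + be q * be q.
  exact: (flag_components_gt0 oO s1 s2 oZ oW alE beE).
have sNbe : smooth_fun O (fun q => - be q) by exact: smooth_opp.
have nz2 q : O q -> (- be q != 0) || (al q != 0).
  move=> Oq; rewrite oppr_eq0 -negb_and; apply: contraTN (nz q Oq).
  by move=> /andP[/eqP -> /eqP ->]; rewrite mul0r addr0 ltxx.
have [la [sla la0 laE]] := normalizing_factor oO s1 s2 oZ sNbe sal nz2.
pose c q := la q * - be q; pose d q := la q * al q.
have sc : smooth_fun O c by exact: smooth_mul.
have sd : smooth_fun O d by exact: smooth_mul.
pose Y : vfield M := fun q => c q *: Z1 q + d q *: Z2 q.
have YD q : O q -> Y q \in D q by exact: combD.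
have sY : smooth_vfield O Y by exact: smooth_vfield_comb2.
(* The coefficients (al, be) have determinant al^2 + be^2 against (- be, al) and pair with (al, be)
   to the same positive value, so both orientation conditions hold for this starting vector. *)
pose W0 : vfield M := fun q => al q *: Z1 q + be q *: Z2 q.
have W0D q : O q -> W0 q \in D q by exact: combD.
have sW0 : smooth_vfield O W0 by exact: smooth_vfield_comb2.
have [s [ss sE]] : exists s, smooth_fun O s /\ forall q, s q = g q (W0 q) (Y q).
  by eexists; split; [apply: (smooth_metric mg oO (X := W0) (Y := Y)); split|].
(* These are the coefficients of W0 minus its projection s Y on the unit field Y. Subtracting a
   multiple of Y preserves the determinant against (c, d), and also the pairing with (al, be)
   because c al + d be = 0; this is [xy] and [xy2]. *)
pose x q := al q - s q * c q; pose y q := be q - s q * d q.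
have sx : smooth_fun O x by apply: smooth_sub => //; exact: smooth_mul.
have sy : smooth_fun O y by apply: smooth_sub => //; exact: smooth_mul.
have xy q : x q * d q - y q * c q = la q * (al q * al q + be q * be q).
  by rewrite /x /y /c /d; ring.
have xy2 q : x q * al q + y q * be q = al q * al q + be q * be q.
  by rewrite /x /y /c /d; ring.
have nz3 q : O q -> (x q != 0) || (y q != 0).
  move=> Oq; rewrite -negb_and; apply: contraTN (nz q Oq).
  by move=> /andP[/eqP x0 /eqP y0]; rewrite -xy2 x0 y0 !mul0r addr0 ltxx.
have [mu [smu mu0 muE]] := normalizing_factor oO s1 s2 oZ sx sy nz3.
pose a q := mu q * x q; pose b q := mu q * y q.
have sa : smooth_fun O a by exact: smooth_mul.
have sb : smooth_fun O b by exact: smooth_mul.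
exists O, (fun q => a q *: Z1 q + b q *: Z2 q), (fun q => c q *: Z1 q + d q *: Z2 q).
split; [exact: oO|exact: conj U1p U2p|].
apply: (adapted_comb2 oO s1 s2 oZ oW alE beE sa sb sc sd).
- move=> q Oq; have gY : g q (Y q) (Y q) = 1.
    have -> : Y q = la q *: (- be q *: Z1 q + al q *: Z2 q).
      by rewrite /Y /c /d scalerDr !scalerA.
    by rewrite (metricZl mg) ?(metricZr mg) ?laE ?memvZ //; exact: combD.
  have EX : a q *: Z1 q + b q *: Z2 q = mu q *: (x q *: Z1 q + y q *: Z2 q).
    by rewrite /a /b scalerDr !scalerA.
  have EX0 : x q *: Z1 q + y q *: Z2 q = - s q *: Y q + W0 q.
    by apply/rowP => j; rewrite /Y /W0 /x /y !mxE; ring.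
  split; [|exact: gY|].
    by rewrite EX (metricZl mg) ?(metricZr mg) ?muE ?memvZ //; exact: combD.
  rewrite EX (metricZl mg) ?EX0; [|by rewrite -EX0; exact: combD|exact: YD].
  rewrite (metricDZl mg); [|exact: YD|exact: W0D|exact: YD].
  by rewrite -/(Y q) gY mulr1 sE addNr mulr0.
- move=> q Oq; have -> : a q * d q - b q * c q = mu q * (la q * (al q * al q + be q * be q)).
    by rewrite -xy /a /b; ring.
  by rewrite !mulr_gt0 ?mu0 ?la0 ?nz.
- move=> q Oq; have -> : a q * al q + b q * be q = mu q * (al q * al q + be q * be q).
    by rewrite -xy2 /a /b; ring.
  by rewrite mulr_gt0 ?mu0 ?nz.
- by move=> q Oq; rewrite /c /d; ring.
Qed.

End AdaptedFrames.

(** * Gluing and uniqueness of the canonical frame *)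

Lemma ord4_cases (i : 'I_4) : [\/ i = idx 1, i = idx 2, i = idx 3 | i = idx 4].
Proof.
have E (j : nat) : (j < 4)%N -> val i = j -> i = inord j.
  by move=> j4 ij; apply/val_inj; rewrite /= inordK.
case: i E => [] [|[|[|[|i]]]] // Hi E.
- by apply: Or41; apply: E.
- by apply: Or42; apply: E.
- by apply: Or43; apply: E.
- by apply: Or44; apply: E.
Qed.

Lemma tnth_idx (T : Type) (a b c d : T) :
  [/\ tnth [tuple a; b; c; d] (idx 1) = a, tnth [tuple a; b; c; d] (idx 2) = b,
      tnth [tuple a; b; c; d] (idx 3) = c & tnth [tuple a; b; c; d] (idx 4) = d].
Proof. by split; rewrite (tnth_nth a) /= inordK. Qed.

Lemma sum_idx (V : nmodType) (F : 'I_4 -> V) :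
  \sum_i F i = F (idx 1) + F (idx 2) + F (idx 3) + F (idx 4).
Proof.
rewrite !big_ord_recl big_ord0 addr0 !addrA.
by congr (F _ + F _ + F _ + F _); apply/val_inj; rewrite /= inordK.
Qed.

Section Canonical.
Context {R : realType} {M : manifold R 4}.
Variables (D : tdistribution M) (g : M -> 'rV[R]_4 -> 'rV[R]_4 -> R).
Variables (oM : M -> 4.-tuple 'rV[R]_4 -> Prop) (oD : M -> 2.-tuple 'rV[R]_4 -> Prop).
Hypothesis engelD : engel D g.
Hypothesis orM : orientation (fun=> fullv) oM.
Hypothesis orD : orientation D oD.

Lemma adapted_global : exists X Y, adapted D g oM oD setT X Y.
Proof.
have H (p : M) : exists t : set M * vfield M * vfield M,
    [/\ open t.1.1, t.1.1 p & adapted D g oM oD t.1.1 t.1.2 t.2].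
  by have [U [X [Y ?]]] := adapted_exists engelD orM orD p; exists (U, X, Y).
have [F HF] := choice H.
(* The glued fields take at q the value of the local frame chosen for q itself. By uniqueness they
   coincide on the domain chosen for p with the frame chosen for p, and so inherit its
   smoothness. *)
pose X : vfield M := fun q => (F q).1.2 q; pose Y : vfield M := fun q => (F q).2 q.
exists X, Y; apply: adapted_local => p _; exists (F p).1.1.
have [oU Up aU] := HF p; split=> //.
have E q : (F p).1.1 q -> (F p).1.2 q = X q /\ (F p).2 q = Y q.
  move=> Uq; have [oU' Uq' aU'] := HF q.
  have oV : open ((F p).1.1 `&` (F q).1.1) by exact: openI.
  have aV := adapted_sub (@subIsetl _ (F p).1.1 (F q).1.1) aU.
  have aV' := adapted_sub (@subIsetr _ (F p).1.1 (F q).1.1) aU'.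
  exact: (adapted_unique engelD orM orD oV aV aV' (conj Uq Uq')).
by apply: adapted_congr oU _ _ aU => q Uq; have [] := E q Uq.
Qed.

Lemma adapted_canonical X Y : adapted D g oM oD setT X Y ->
  canonical_frame D g oM oD (tnth [tuple X; Y; lie X Y; lie X (lie X Y)]).
Proof.
move=> aXY; rewrite /canonical_frame.
have [-> -> -> ->] := tnth_idx X Y (lie X Y) (lie X (lie X Y)).
have bF p := adapted_flag orM aXY (I : setT p).
case: aXY => [[sX sY] onXY inXY oMXY oDXY].
have sL := smooth_lie openT sX sY.
split.
- split=> [i|p]; first exact: smooth_tuple4 sX sY sL (smooth_lie openT sX sL).
  by rewrite frame4; exact: bF.
- by move=> p; exact: onXY.
- by split=> // p; exact: inXY.
- by move=> p; exact: oMXY.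
- by move=> p; exact: oDXY.
Qed.

Lemma canonical_adapted F : canonical_frame D g oM oD F ->
  [/\ adapted D g oM oD setT (F (idx 1)) (F (idx 2)),
      F (idx 3) = lie (F (idx 1)) (F (idx 2)) &
      F (idx 4) = lie (F (idx 1)) (lie (F (idx 1)) (F (idx 2)))].
Proof.
rewrite /canonical_frame.
move: (F (idx 3)) (F (idx 4)) => X3 X4 [[sF _] onF [E3 E4 inF] oMF oDF].
subst X4 X3; split; [split|by []|by []].
- by split; exact: sF.
- by move=> p _; exact: onF.
- by move=> p _; exact: inF.
- by move=> p _; exact: oMF.
- by move=> p _; exact: oDF.
Qed.

Lemma canonical_unique F G : canonical_frame D g oM oD F ->
  canonical_frame D g oM oD G -> F = G.
Proof.
move=> /canonical_adapted[aF F3 F4] /canonical_adapted[aG G3 G4].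
have U p := adapted_unique engelD orM orD openT aF aG (I : setT p).
have E1 : F (idx 1) = G (idx 1) by apply/funext => p; have [] := U p.
have E2 : F (idx 2) = G (idx 2) by apply/funext => p; have [] := U p.
have E12 := congr2 lie E1 E2.
have E3 := etrans F3 (etrans E12 (esym G3)).
have E4 := etrans F4 (etrans (congr2 lie E1 E12) (esym G4)).
apply/funext => i.
by case: (ord4_cases i) => ->; [exact: E1|exact: E2|exact: E3|exact: E4].
Qed.

End Canonical.

(** * Structure equations *)

Section StructureEquations.
Context {R : realType} {M : manifold R 4}.
Variables (X1 X2 X3 X4 : vfield M).
Hypotheses (s1 : smooth_vfield setT X1) (s2 : smooth_vfield setT X2).
Hypotheses (s3 : smooth_vfield setT X3) (s4 : smooth_vfield setT X4).

Lemma lie_comb3 Z (a b c : M -> R) p : smooth_vfield setT Z ->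
  smooth_fun setT a -> smooth_fun setT b -> smooth_fun setT c ->
  lie Z (fun q => a q *: X1 q + b q *: X2 q + c q *: X3 q) p =
  (a p *: lie Z X1 p + dir Z a p *: X1 p) + (b p *: lie Z X2 p + dir Z b p *: X2 p)
  + (c p *: lie Z X3 p + dir Z c p *: X3 p).
Proof.
move=> sZ sa sb sc.
have sab := smooth_vfield_comb2 openT sa sb s1 s2.
have scX := smooth_vfield_scale openT sc s3.
have Op : setT p by [].
apply: etrans (lie_add_r openT sZ sab scX Op) _.
exact: congr2 (lie_comb2_r openT sZ sa sb s1 s2 Op) (lie_scale_r openT sZ sc s3 Op).
Qed.

Lemma lie_comb4 Z (a b c d : M -> R) p : smooth_vfield setT Z ->
  smooth_fun setT a -> smooth_fun setT b -> smooth_fun setT c -> smooth_fun setT d ->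
  lie Z (fun q => a q *: X1 q + b q *: X2 q + c q *: X3 q + d q *: X4 q) p =
  (a p *: lie Z X1 p + dir Z a p *: X1 p) + (b p *: lie Z X2 p + dir Z b p *: X2 p)
  + (c p *: lie Z X3 p + dir Z c p *: X3 p) + (d p *: lie Z X4 p + dir Z d p *: X4 p).
Proof.
move=> sZ sa sb sc sd.
have sab := smooth_vfield_comb2 openT sa sb s1 s2.
have sabc := smooth_vfield_add openT sab (smooth_vfield_scale openT sc s3).
have sdX := smooth_vfield_scale openT sd s4.
have Op : setT p by [].
apply: etrans (lie_add_r openT sZ sabc sdX Op) _.
exact: congr2 (lie_comb3 p sZ sa sb sc) (lie_scale_r openT sZ sd s4 Op).
Qed.

Hypotheses (h12 : lie X1 X2 = X3) (h13 : lie X1 X3 = X4).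
Hypothesis fr : forall p, basis_of fullv [tuple X1 p; X2 p; X3 p; X4 p].

Lemma frame_inj p (a b c d a' b' c' d' : R) :
  a *: X1 p + b *: X2 p + c *: X3 p + d *: X4 p =
  a' *: X1 p + b' *: X2 p + c' *: X3 p + d' *: X4 p ->
  [/\ a = a', b = b', c = c' & d = d'].
Proof.
move=> E.
have F := elimT (@freeP _ _ _ [tuple X1 p; X2 p; X3 p; X4 p]) (basis_free (fr p))
  (tnth [tuple a - a'; b - b'; c - c'; d - d']).
have {}F i : tnth [tuple a - a'; b - b'; c - c'; d - d'] i = 0.
  apply: F; rewrite !big_ord_recl big_ord0 addr0 /=.
  rewrite !(tnth_nth 0) /= !scalerBl.
  move/eqP: E; rewrite -subr_eq0 => /eqP E; rewrite -[RHS]E.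
  by rewrite !opprD !addrA; apply/rowP => j; rewrite !mxE; ring.
split; apply/eqP; rewrite -subr_eq0; apply/eqP.
- exact: (F ord0).
- exact: (F (lift ord0 ord0)).
- exact: (F (lift ord0 (lift ord0 ord0))).
- exact: (F (lift ord0 (lift ord0 (lift ord0 ord0)))).
Qed.

Variables (T1 T2 T3 T4 T5 T6 C K1 K2 K3 K4 : M -> R).
Hypotheses (t1 : smooth_fun setT T1) (t2 : smooth_fun setT T2).
Hypotheses (t3 : smooth_fun setT T3) (t4 : smooth_fun setT T4).
Hypotheses (t5 : smooth_fun setT T5) (t6 : smooth_fun setT T6).
Hypotheses (sC : smooth_fun setT C) (k1 : smooth_fun setT K1) (k2 : smooth_fun setT K2).
Hypotheses (k3 : smooth_fun setT K3).
Hypothesis h14 : forall p, lie X1 X4 p =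
  C p *: X1 p + T5 p *: X2 p + T3 p *: X3 p + T1 p *: X4 p.
Hypothesis h23 : forall p, lie X2 X3 p = T6 p *: X1 p + T4 p *: X2 p + T2 p *: X3 p.
Hypothesis h34 : forall p, lie X3 X4 p =
  K1 p *: X1 p + K2 p *: X2 p + K3 p *: X3 p + K4 p *: X4 p.

Let sd Z (f : M -> R) : smooth_vfield setT Z -> smooth_fun setT f -> smooth_fun setT (dir Z f).
Proof. exact: smooth_dir openT. Qed.

(** As [[X1, X2], X3] = [X3, X3] = 0, the Jacobi identity reduces [X2, X4] = [X2, [X1, X3]] to [X1,
    [X2, X3]], and [X2, X3] has no X4-component. *)
Lemma structure24 p : lie X2 X4 p = dir X1 T6 p *: X1 p + dir X1 T4 p *: X2 p
  + (T4 p + dir X1 T2 p) *: X3 p + T2 p *: X4 p.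
Proof.
have J := jacobi openT s1 s2 s3 (I : setT p).
rewrite h12 h13 liexx add0r in J.
have E := lie_loc openT (I : setT p) (fun q _ => erefl (X1 q)) (fun q _ => h23 q).
have L := lie_comb3 p s1 t6 t4 t2.
rewrite liexx h12 h13 in L.
have {}J := etrans (esym J) E.
have {}J := etrans J L.
apply: etrans J _.
move: (X1 p) (X2 p) (X3 p) (X4 p) (dir X1 T6 p) (dir X1 T4 p) (dir X1 T2 p).
move=> x1 x2 x3 x4 u v w; apply/rowP => j; rewrite !mxE; ring.
Qed.

Let h21 p : lie X2 X1 p = - X3 p.
Proof. by apply: etrans (lieC _ _ _) _; rewrite h12. Qed.

Let h31 p : lie X3 X1 p = - X4 p.
Proof. by apply: etrans (lieC _ _ _) _; rewrite h13. Qed.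

Let h32 p : lie X3 X2 p = - (T6 p *: X1 p + T4 p *: X2 p + T2 p *: X3 p).
Proof. by apply: etrans (lieC _ _ _) _; rewrite h23. Qed.

Let sT4T2 : smooth_fun setT (fun q => T4 q + dir X1 T2 q).
Proof. by apply: smooth_add openT t4 _; exact: sd. Qed.

(* By [X3, X4] = [X1, [X2, X4]] - [X2, [X1, X4]]. *)
Lemma structure34 p :
  [/\ K1 p = T2 p * C p - T6 p * T3 p - T1 p * dir X1 T6 p - dir X2 C p
             + dir X1 (dir X1 T6) p,
      K2 p = T2 p * T5 p - T3 p * T4 p - T1 p * dir X1 T4 p - dir X2 T5 p
             + dir X1 (dir X1 T4) p,
      K3 p = C p + 2 * dir X1 T4 p + dir X1 (dir X1 T2) p - dir X2 T3 p
             - T1 p * T4 p - T1 p * dir X1 T2 p &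
      K4 p = T4 p + 2 * dir X1 T2 p - dir X2 T1 p].
Proof.
have J := jacobi openT s1 s2 s4 (I : setT p).
rewrite h12 in J.
have E1 := lie_loc openT (I : setT p) (fun q _ => erefl (X1 q)) (fun q _ => structure24 q).
have L1 := lie_comb4 p s1 (sd s1 t6) (sd s1 t4) sT4T2 t2.
have D1 := dir_add openT (I : setT p) X1 t4 (sd s1 t2).
have E2 := lie_loc openT (I : setT p) (fun q _ => erefl (X2 q)) (fun q _ => h14 q).
have L2 := lie_comb4 p s2 sC t5 t3 t1.
rewrite D1 liexx h12 h13 h14 in L1.
rewrite h21 liexx h23 structure24 in L2.
have sub (u v w : 'rV[R]_4) : u = v + w -> v = u - w by move=> ->; rewrite addrK.
have {}J := etrans (esym (h34 p)) (sub _ _ _ J).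
have F1 := etrans E1 L1; have F2 := etrans E2 L2.
have {}J := etrans J (congr2 (fun u v => u - v) F1 F2).
apply: frame_inj; apply: etrans J _.
move: (X1 p) (X2 p) (X3 p) (X4 p) (dir X1 (dir X1 T6) p) (dir X1 (dir X1 T4) p)
  (dir X1 (dir X1 T2) p) (dir X1 T6 p) (dir X1 T4 p) (dir X1 T2 p)
  (dir X2 C p) (dir X2 T5 p) (dir X2 T3 p) (dir X2 T1 p).
move=> x1 x2 x3 x4 a b c d e f a' b' c' d'; apply/rowP => j; rewrite !mxE; ring.
Qed.

Let EE p : dir X1 (fun q => dir X2 T1 q - 2 * dir X1 T2 q) p =
  dir X1 (dir X2 T1) p - 2 * dir X1 (dir X1 T2) p.
Proof.
have s2c := @smooth_cst R _ M setT 2.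
have e1 := dir_mul openT (I : setT p) X1 s2c (sd s1 t2).
rewrite dir_cst mulr0 addr0 in e1.
rewrite -e1.
exact: (dir_sub openT (I : setT p) X1 (sd s2 t1) (smooth_mul openT s2c (sd s1 t2))).
Qed.

(* By the X4-component of [X1, [X3, X4]] = [X3, [X1, X4]]. *)
Lemma structure14 p :
  C p = 2^-1 * (T1 p * T4 p + T1 p * dir X1 T2 p - 3 * dir X1 T4 p + dir X2 T3 p
                + dir X3 T1 p - dir X1 (dir X1 T2) p
                + dir X1 (fun q => dir X2 T1 q - 2 * dir X1 T2 q) p) /\
  K3 p = - 2^-1 * (T1 p * T4 p + T1 p * dir X1 T2 p - dir X1 T4 p + dir X2 T3 p
                - dir X3 T1 p - dir X1 (dir X1 T2) p
                - dir X1 (fun q => dir X2 T1 q - 2 * dir X1 T2 q) p).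
Proof.
(* K4 is replaced by its value from [structure34], which is visibly smooth; its X1-derivative brings
   in the second derivatives that make up [E]. *)
pose k4 q := T4 q + 2 * dir X1 T2 q - dir X2 T1 q.
have s2c := @smooth_cst R _ M setT 2.
have s22 := smooth_mul openT s2c (sd s1 t2).
have s4a := smooth_add openT t4 s22.
have sk4 : smooth_fun setT k4 := smooth_sub openT s4a (sd s2 t1).
have Dk4 : dir X1 k4 p = dir X1 T4 p + 2 * dir X1 (dir X1 T2) p - dir X1 (dir X2 T1) p.
  have e1 := dir_sub openT (I : setT p) X1 s4a (sd s2 t1).
  have e2 := dir_add openT (I : setT p) X1 t4 s22.
  have e3 := dir_mul openT (I : setT p) X1 s2c (sd s1 t2).
  rewrite dir_cst mulr0 addr0 in e3.
  by rewrite e2 e3 in e1.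
have h34' q : lie X3 X4 q = K1 q *: X1 q + K2 q *: X2 q + K3 q *: X3 q + k4 q *: X4 q.
  by have [_ _ _ Ek] := structure34 q; rewrite h34 Ek.
have J := jacobi openT s1 s3 s4 (I : setT p).
rewrite h13 liexx add0r in J.
have E1 := lie_loc openT (I : setT p) (fun q _ => erefl (X1 q)) (fun q _ => h34' q).
have L1 := lie_comb4 p s1 k1 k2 k3 sk4.
have E2 := lie_loc openT (I : setT p) (fun q _ => erefl (X3 q)) (fun q _ => h14 q).
have L2 := lie_comb4 p s3 sC t5 t3 t1.
rewrite liexx h12 h13 h14 in L1.
rewrite h31 h32 liexx h34' in L2.
have F1 := etrans E1 L1; have F2 := etrans E2 L2.
have {}J := etrans (esym F1) J.
have {}J := etrans J F2.
have [_ _ EK3 _] := structure34 p.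
(* All four components are written out so that [frame_inj] applies, but only the last is kept. *)
have X4comp : K3 p + dir X1 k4 p + k4 p * T1 p = - C p + T1 p * k4 p + dir X3 T1 p.
  have [|_ _ _ H] := @frame_inj p (k4 p * C p + dir X1 K1 p)
    (k4 p * T5 p + dir X1 K2 p) (K2 p + dir X1 K3 p + k4 p * T3 p)
    (K3 p + dir X1 k4 p + k4 p * T1 p)
    (dir X3 C p - T5 p * T6 p + T1 p * K1 p)
    (dir X3 T5 p - T5 p * T4 p + T1 p * K2 p)
    (dir X3 T3 p - T5 p * T2 p + T1 p * K3 p)
    (- C p + T1 p * k4 p + dir X3 T1 p).
    apply: etrans (etrans _ J) _; move: (X1 p) (X2 p) (X3 p) (X4 p) (dir X1 K1 p)
      (dir X1 K2 p) (dir X1 K3 p) (dir X1 k4 p) (dir X3 C p) (dir X3 T5 p)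
      (dir X3 T3 p) (dir X3 T1 p) => x1 x2 x3 x4 a b c d e f h k;
      by apply/rowP => j; rewrite !mxE; ring.
  exact: H.
(* Eliminating K3 leaves one linear equation in which C has coefficient 2; both formulas follow from
   it. *)
rewrite Dk4 EK3 in X4comp; rewrite EK3 EE.
move: X4comp; rewrite /k4.
move: (dir X1 (dir X1 T2) p) (dir X1 (dir X2 T1) p) (dir X1 T4 p) (dir X1 T2 p)
  (dir X2 T3 p) (dir X2 T1 p) (dir X3 T1 p) (C p) (T1 p) (T4 p) => a b c d e f h k l m H.
have half (x y : R) : 2 * x = y -> x = 2^-1 * y.
  by move=> <-; rewrite mulKf // pnatr_eq0.
move/eqP: H; rewrite -subr_eq0 => /eqP Z.
split; [|rewrite mulNr -mulrN]; apply: half; apply/eqP; rewrite -subr_eq0; apply/eqP;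
  rewrite -[RHS]Z; ring.
Qed.

End StructureEquations.

(** * Structure functions as differential polynomials *)

Definition dT1 := DInv (@Ordinal 6 0 isT).
Definition dT2 := DInv (@Ordinal 6 1 isT).
Definition dT3 := DInv (@Ordinal 6 2 isT).
Definition dT4 := DInv (@Ordinal 6 3 isT).
Definition dT5 := DInv (@Ordinal 6 4 isT).
Definition dT6 := DInv (@Ordinal 6 5 isT).
(** [dpoly] has neither subtraction nor division: signs and halves enter as rational constants. *)
Definition dscale (c : rat) (e : dpoly) := DMul (DCst c) e.
Definition dX (j : nat) (e : dpoly) := DDer (idx j) e.
Definition dsum (s : seq dpoly) : dpoly := foldr DAdd (DCst 0) s.

(** It represents T4 minus the X4-component of [X3, X4]; its X1-derivative is the term [E]. *)
Definition dE : dpoly := DAdd (dX 2 dT1) (dscale (- 2%:R) (dX 1 dT2)).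

Definition dC1_14 : dpoly :=
  dscale (2%:R^-1) (dsum [:: DMul dT1 dT4; DMul dT1 (dX 1 dT2); dscale (- 3%:R) (dX 1 dT4);
    dX 2 dT3; dX 3 dT1; dscale (- 1) (dX 1 (dX 1 dT2)); dX 1 dE]).

Definition dC3_34 : dpoly :=
  dscale (- 2%:R^-1) (dsum [:: DMul dT1 dT4; DMul dT1 (dX 1 dT2); dscale (- 1) (dX 1 dT4);
    dX 2 dT3; dscale (- 1) (dX 3 dT1); dscale (- 1) (dX 1 (dX 1 dT2)); dscale (- 1) (dX 1 dE)]).

Definition dC2_34 : dpoly :=
  dsum [:: DMul dT2 dT5; dscale (- 1) (DMul dT3 dT4); dscale (- 1) (DMul dT1 (dX 1 dT4));
    dscale (- 1) (dX 2 dT5); dX 1 (dX 1 dT4)].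

Definition dC1_34 : dpoly :=
  dsum [:: DMul dT2 dC1_14; dscale (- 1) (DMul dT6 dT3); dscale (- 1) (DMul dT1 (dX 1 dT6));
    dscale (- 1) (dX 2 dC1_14); dX 1 (dX 1 dT6)].

Definition dC4_34 : dpoly :=
  dsum [:: dT4; dscale 2%:R (dX 1 dT2); dscale (- 1) (dX 2 dT1)].

(* The components of [X_i, X_j], i < j, with indices counted from 0. *)
Definition structure_row (i j : nat) : seq dpoly :=
  match i, j with
  | 0, 1 => [:: DCst 0; DCst 0; DCst 1; DCst 0]
  | 0, 2 => [:: DCst 0; DCst 0; DCst 0; DCst 1]
  | 0, 3 => [:: dC1_14; dT5; dT3; dT1]
  | 1, 2 => [:: dT6; dT4; dT2; DCst 0]
  | 1, 3 => [:: dX 1 dT6; dX 1 dT4; DAdd dT4 (dX 1 dT2); dT2]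
  | 2, 3 => [:: dC1_34; dC2_34; dC3_34; dC4_34]
  | _, _ => [::]
  end.

(** Antisymmetry gives the entries below the diagonal. On the diagonal the row is empty, and the
    default value of [nth] gives zero. *)
Definition structure_dpoly (i j k : 'I_4) : dpoly :=
  if (i < j)%N then nth (DCst 0) (structure_row i j) k
  else dscale (- 1) (nth (DCst 0) (structure_row j i) k).

Section StructureFunctions.
Context {R : realType} {M : manifold R 4}.
Variables (D : tdistribution M) (g : M -> 'rV[R]_4 -> 'rV[R]_4 -> R).
Variables (oM : M -> 4.-tuple 'rV[R]_4 -> Prop) (oD : M -> 2.-tuple 'rV[R]_4 -> Prop).
Variable F : 'I_4 -> vfield M.
Hypothesis cF : canonical_frame D g oM oD F.

Let X1 := F (idx 1).
Let X2 := F (idx 2).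
Let X3 := F (idx 3).
Let X4 := F (idx 4).
Let S (k i j : nat) : M -> R := structure_fun F (idx i) (idx j) (idx k).

Let sF i : smooth_vfield setT (F i).
Proof. by case: cF => [[]]. Qed.

Let bF p : basis_of fullv (frame_at F p).
Proof. by case: cF => [[]]. Qed.

Lemma frame_idx p : frame_at F p = [tuple X1 p; X2 p; X3 p; X4 p].
Proof.
apply: eq_from_tnth => i; rewrite tnth_mktuple.
have [e1 e2 e3 e4] := tnth_idx (X1 p) (X2 p) (X3 p) (X4 p).
case: (ord4_cases i) => ->; [exact: esym e1|exact: esym e2|exact: esym e3|exact: esym e4].
Qed.

Let b4 p : basis_of fullv [tuple X1 p; X2 p; X3 p; X4 p].
Proof. by rewrite -frame_idx. Qed.

Lemma smooth_structure_fun i j k : smooth_fun setT (structure_fun F i j k).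
Proof.
apply: (smooth_coord_frame openT _ sF (smooth_lie openT (sF i) (sF j))).
  by move=> q _; exact: basis_free (bF q).
by move=> q _; rewrite (span_basis (bF q)); exact: memvf.
Qed.

Lemma lie_structure i j p : lie (F i) (F j) p =
  structure_fun F i j (idx 1) p *: X1 p + structure_fun F i j (idx 2) p *: X2 p +
  structure_fun F i j (idx 3) p *: X3 p + structure_fun F i j (idx 4) p *: X4 p.
Proof.
apply: etrans (coord_basis (bF p) (memvf (lie (F i) (F j) p))) _.
apply: etrans (sum_idx _) _.
have e (k : 'I_4) : (frame_at F p)`_k = F k p by exact: frame_atE.
by rewrite !e.
Qed.

Lemma structure_funE i j p a b c d :
  lie (F i) (F j) p = a *: X1 p + b *: X2 p + c *: X3 p + d *: X4 p ->
  [/\ structure_fun F i j (idx 1) p = a, structure_fun F i j (idx 2) p = b,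
      structure_fun F i j (idx 3) p = c & structure_fun F i j (idx 4) p = d].
Proof. by move=> E; apply: (frame_inj b4); exact: etrans (esym (lie_structure i j p)) E. Qed.

Lemma structure_fun_anti i j k p : structure_fun F i j k p = - structure_fun F j i k p.
Proof.
rewrite -linearN; apply: (congr1 (coord (frame_at F p) k)).
exact: lieC.
Qed.

Let h12 : lie X1 X2 = X3. Proof. by case: cF => _ _ [H _ _] _ _. Qed.
Let h13 : lie X1 X3 = X4. Proof. by case: cF => _ _ [_ H _] _ _. Qed.

Let h14 p := lie_structure (idx 1) (idx 4) p.
Let h34 p := lie_structure (idx 3) (idx 4) p.

Lemma structure23 p : lie X2 X3 p =
  S 1 2 3 p *: X1 p + S 2 2 3 p *: X2 p + S 3 2 3 p *: X3 p.
Proof.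
have /span3P[a [b [c E]]] : lie X2 X3 p \in <<[:: X1 p; X2 p; X3 p]>>%VS.
  by case: cF => _ _ [_ _ H] _ _; exact: H.
have E' : lie X2 X3 p = a *: X1 p + b *: X2 p + c *: X3 p + 0 *: X4 p.
  by rewrite scale0r addr0.
have [e1 e2 e3 _] := structure_funE E'.
by rewrite E /S e1 e2 e3.
Qed.

Let C k i j := structure_fun F (idx i) (idx j) (idx k).
Let T1 := (C 4 1 4)%N.
Let T2 := (C 3 2 3)%N.
Let T3 := (C 3 1 4)%N.
Let T4 := (C 2 2 3)%N.
Let T5 := (C 2 1 4)%N.
Let T6 := (C 1 2 3)%N.
Let C1_14 := (C 1 1 4)%N.
Let C1_34 := (C 1 3 4)%N.
Let C2_34 := (C 2 3 4)%N.
Let C3_34 := (C 3 3 4)%N.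
Let C4_34 := (C 4 3 4)%N.

Let sC k i j : smooth_fun setT (C k i j).
Proof. exact: smooth_structure_fun. Qed.

Let s24 p : lie X2 X4 p = dir X1 T6 p *: X1 p + dir X1 T4 p *: X2 p
  + (T4 p + dir X1 T2 p) *: X3 p + T2 p *: X4 p.
Proof.
exact: (structure24 (sF _) (sF _) (sF _) h12 h13 (sC _ _ _) (sC _ _ _) (sC _ _ _) structure23 p).
Qed.

Let s34 p := structure34 (sF _) (sF _) (sF _) (sF _) h12 h13 b4
  (sC 4 1 4) (sC 3 2 3) (sC 3 1 4) (sC 2 2 3) (sC 2 1 4) (sC 1 2 3) (sC 1 1 4)
  h14 structure23 h34 p.

Let s14 p := structure14 (sF _) (sF _) (sF _) (sF _) h12 h13 b4
  (sC 4 1 4) (sC 3 2 3) (sC 3 1 4) (sC 2 2 3) (sC 2 1 4) (sC 1 2 3) (sC 1 1 4)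
  (sC 1 3 4) (sC 2 3 4) (sC 3 3 4) h14 structure23 h34 p.

Lemma canonical_equations p :
  let E := dir X1 (fun q => dir X2 T1 q - 2 * dir X1 T2 q) in
  [/\ lie X1 X4 p = C1_14 p *: X1 p + T5 p *: X2 p + T3 p *: X3 p + T1 p *: X4 p,
      lie X2 X3 p = T6 p *: X1 p + T4 p *: X2 p + T2 p *: X3 p,
      lie X2 X4 p = dir X1 T6 p *: X1 p + dir X1 T4 p *: X2 p
                    + (T4 p + dir X1 T2 p) *: X3 p + T2 p *: X4 p,
      lie X3 X4 p = C1_34 p *: X1 p + C2_34 p *: X2 p + C3_34 p *: X3 p
                    + (T4 p + 2 * dir X1 T2 p - dir X2 T1 p) *: X4 p &
      [/\ C1_14 p = 2^-1 * (T1 p * T4 p + T1 p * dir X1 T2 p - 3 * dir X1 T4 p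
             + dir X2 T3 p + dir X3 T1 p - dir X1 (dir X1 T2) p + E p),
          C3_34 p = - 2^-1 * (T1 p * T4 p + T1 p * dir X1 T2 p - dir X1 T4 p
             + dir X2 T3 p - dir X3 T1 p - dir X1 (dir X1 T2) p - E p),
          C2_34 p = T2 p * T5 p - T3 p * T4 p - T1 p * dir X1 T4 p
             - dir X2 T5 p + dir X1 (dir X1 T4) p &
          C1_34 p = T2 p * C1_14 p - T6 p * T3 p - T1 p * dir X1 T6 p
             - dir X2 C1_14 p + dir X1 (dir X1 T6) p]].
Proof.
have [e1 e2 _ e4] := s34 p; have [f1 f3] := s14 p.
split; [exact: h14|exact: structure23|exact: s24| |split; [exact: f1|exact: f3|exact: e2|exact: e1]].
apply: etrans (h34 p) _.
exact: (congr1 (fun c => _ + c *: X4 p) e4).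
Qed.

Let ev := dpoly_eval F.

Let r0 : ratr 0 = 0 :> R. Proof. exact: rmorph0. Qed.
Let r1 : ratr 1 = 1 :> R. Proof. exact: rmorph1. Qed.
Let rN1 : ratr (- 1) = - 1 :> R. Proof. exact: rmorphN1. Qed.
Let r2 : ratr 2%:R = 2 :> R. Proof. exact: rmorph_nat. Qed.
Let rN2 : ratr (- 2%:R) = - 2 :> R. Proof. by rewrite rmorphN rmorph_nat. Qed.
Let rN3 : ratr (- 3%:R) = - 3 :> R. Proof. by rewrite rmorphN rmorph_nat. Qed.
Let rV2 : ratr (2%:R^-1) = 2^-1 :> R. Proof. by rewrite fmorphV rmorph_nat. Qed.
Let rNV2 : ratr (- 2%:R^-1) = - 2^-1 :> R. Proof. by rewrite rmorphN fmorphV rmorph_nat. Qed.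

Let evE : ev dE = (fun q => dir X2 T1 q - 2 * dir X1 T2 q).
Proof.
apply/funext => q.
apply: (@etrans _ _ (dir X2 T1 q + ratr (- 2%:R) * dir X1 T2 q)); first exact: erefl.
by rewrite rN2 mulNr.
Qed.

Let evC1_14 : ev dC1_14 = C1_14.
Proof.
apply/funext => p; apply: etrans _ (esym (s14 p).1).
(* The evaluation of the polynomial written out by conversion: sums nest to the right and end in the
   zero of [dsum], and constants appear under [ratr]. The following evaluations have the same
   form. *)
apply: (@etrans _ _ (ratr (2%:R^-1) * (T1 p * T4 p + (T1 p * dir X1 T2 p +
  (ratr (- 3%:R) * dir X1 T4 p + (dir X2 T3 p + (dir X3 T1 p +
  (ratr (- 1) * dir X1 (dir X1 T2) p + (dir X1 (ev dE) p + ratr 0)))))))));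
  first exact: erefl.
have alg (a b c d e f h h' v n3 n1 z : R) : h = h' -> v = 2^-1 -> n3 = - 3 ->
  n1 = - 1 -> z = 0 ->
  v * (a + (b + (n3 * c + (d + (e + (n1 * f + (h + z))))))) =
  2^-1 * (a + b - 3 * c + d + e - f + h') by move=> -> -> -> -> ->; ring.
exact: alg (congr1 (fun f => dir X1 f p) evE) rV2 rN3 rN1 r0.
Qed.

Let evC3_34 : ev dC3_34 = C3_34.
Proof.
apply/funext => p; apply: etrans _ (esym (s14 p).2).
apply: (@etrans _ _ (ratr (- 2%:R^-1) * (T1 p * T4 p + (T1 p * dir X1 T2 p +
  (ratr (- 1) * dir X1 T4 p + (dir X2 T3 p + (ratr (- 1) * dir X3 T1 p +
  (ratr (- 1) * dir X1 (dir X1 T2) p + (ratr (- 1) * dir X1 (ev dE) p + ratr 0)))))))));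
  first exact: erefl.
have alg (a b c d e f h h' v n1 z : R) : h = h' -> v = - 2^-1 ->
  n1 = - 1 -> z = 0 ->
  v * (a + (b + (n1 * c + (d + (n1 * e + (n1 * f + (n1 * h + z))))))) =
  - 2^-1 * (a + b - c + d - e - f - h') by move=> -> -> -> ->; ring.
exact: alg (congr1 (fun f => dir X1 f p) evE) rNV2 rN1 r0.
Qed.

Let evC2_34 : ev dC2_34 = C2_34.
Proof.
apply/funext => p; have [_ e _ _] := s34 p; apply: etrans _ (esym e).
apply: (@etrans _ _ (T2 p * T5 p + (ratr (- 1) * (T3 p * T4 p) +
  (ratr (- 1) * (T1 p * dir X1 T4 p) + (ratr (- 1) * dir X2 T5 p +
  (dir X1 (dir X1 T4) p + ratr 0))))));
  first exact: erefl.
have alg (a b c d f n1 z : R) : n1 = - 1 -> z = 0 ->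
  a + (n1 * b + (n1 * c + (n1 * d + (f + z)))) = a - b - c - d + f.
  by move=> -> ->; ring.
exact: alg rN1 r0.
Qed.

Let evC1_34 : ev dC1_34 = C1_34.
Proof.
apply/funext => p; have [e _ _ _] := s34 p; apply: etrans _ (esym e).
apply: (@etrans _ _ (T2 p * ev dC1_14 p + (ratr (- 1) * (T6 p * T3 p) +
  (ratr (- 1) * (T1 p * dir X1 T6 p) + (ratr (- 1) * dir X2 (ev dC1_14) p +
  (dir X1 (dir X1 T6) p + ratr 0))))));
  first exact: erefl.
have alg (t a a' b c d d' f n1 z : R) : a = a' -> d = d' -> n1 = - 1 -> z = 0 ->
  t * a + (n1 * b + (n1 * c + (n1 * d + (f + z)))) = t * a' - b - c - d' + f.
  by move=> -> -> -> ->; ring.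
exact: alg (congr1 (fun f => f p) evC1_14) (congr1 (fun f => dir X2 f p) evC1_14) rN1 r0.
Qed.

Let evC4_34 : ev dC4_34 = C4_34.
Proof.
apply/funext => p; have [_ _ _ e] := s34 p; apply: etrans _ (esym e).
apply: (@etrans _ _ (T4 p + (ratr 2%:R * dir X1 T2 p + (ratr (- 1) * dir X2 T1 p + ratr 0))));
  first exact: erefl.
have alg (a b c n2 n1 z : R) : n2 = 2 -> n1 = - 1 -> z = 0 ->
  a + (n2 * b + (n1 * c + z)) = a + 2 * b - c by move=> -> -> ->; ring.
exact: alg r2 rN1 r0.
Qed.

Let row_eval (i j : 'I_4) p (e1 e2 e3 e4 : dpoly) k :
  lie (F i) (F j) p = ev e1 p *: X1 p + ev e2 p *: X2 p + ev e3 p *: X3 p + ev e4 p *: X4 p ->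
  structure_fun F i j k p = ev (nth (DCst 0) [:: e1; e2; e3; e4] k) p.
Proof.
move=> /structure_funE[f1 f2 f3 f4].
case: (ord4_cases k) => Ek; have vk : val k = _ := congr1 val Ek;
  rewrite /= inordK // in vk; rewrite vk Ek /=;
  [exact: f1|exact: f2|exact: f3|exact: f4].
Qed.

Let upper (i j k : 'I_4) p : (i < j)%N ->
  structure_fun F i j k p = ev (nth (DCst 0) (structure_row i j) k) p.
Proof.
have val_of (a : 'I_4) (n : nat) : a = idx n -> (0 < n <= 4)%N -> val a = n.-1.
  by case: n => // n -> /= n4; rewrite inordK.
case: (ord4_cases i) => Ei; case: (ord4_cases j) => Ej;
  have vi := val_of _ _ Ei isT; have vj := val_of _ _ Ej isT;
  move: vi vj => /= vi vj; rewrite vi vj // => _.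
(* Six pairs i < j remain, in lexicographic order. *)
all: apply: row_eval; rewrite Ei Ej.
- apply: etrans (congr1 (fun v : vfield M => v p) h12) _.
  have unit0 (x y z t : 'rV[R]_4) (a b : R) : a = 0 -> b = 1 ->
    z = a *: x + a *: y + b *: z + a *: t.
    by move=> -> ->; rewrite !scale0r scale1r !add0r addr0.
  exact: unit0 r0 r1.
- apply: etrans (congr1 (fun v : vfield M => v p) h13) _.
  have unit0 (x y z t : 'rV[R]_4) (a b : R) : a = 0 -> b = 1 ->
    t = a *: x + a *: y + a *: z + b *: t.
    by move=> -> ->; rewrite !scale0r scale1r !add0r.
  exact: unit0 r0 r1.
- apply: etrans (h14 p) _.
  have cong (x y z t : 'rV[R]_4) (a a' b c d : R) : a' = a ->
    a *: x + b *: y + c *: z + d *: t = a' *: x + b *: y + c *: z + d *: t.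
    by move=> ->.
  exact: cong (congr1 (fun f : M -> R => f p) evC1_14).
- apply: etrans (structure23 p) _.
  have add0 (u x : 'rV[R]_4) (a : R) : a = 0 -> u = u + a *: x.
    by move=> ->; rewrite scale0r addr0.
  exact: add0 r0.
- exact: s24.
- apply: etrans (h34 p) _.
  have cong (x y z t : 'rV[R]_4) (a b c d a' b' c' d' : R) : a' = a -> b' = b ->
    c' = c -> d' = d ->
    a *: x + b *: y + c *: z + d *: t = a' *: x + b' *: y + c' *: z + d' *: t.
    by move=> -> -> -> ->.
  have at_p (f f' : M -> R) : f = f' -> f p = f' p by move=> ->.
  exact: cong (at_p _ _ evC1_34) (at_p _ _ evC2_34) (at_p _ _ evC3_34) (at_p _ _ evC4_34).
Qed.

Lemma structure_dpolyE i j k : structure_fun F i j k = dpoly_eval F (structure_dpoly i j k).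
Proof.
apply/funext => p; rewrite /structure_dpoly; case: ltnP => [ij|ji]; first exact: upper.
apply: etrans (structure_fun_anti i j k p) _.
have opp (a b c : R) : a = b -> c = - 1 -> - a = c * b by move=> -> ->; rewrite mulN1r.
apply: opp rN1; move: ji; rewrite leq_eqVlt => /orP[/eqP ji|]; last exact: upper.
have ij : i = j by apply/val_inj.
apply: etrans (_ : 0 = _).
  rewrite ij; apply: etrans (congr1 (coord (frame_at F p) k) (liexx (F j) p)) _.
  exact: linear0.
rewrite ij; apply: etrans (esym r0) _.
by case: (j) => [] [|[|[|[|]]]] // Hj; rewrite /= nth_nil.
Qed.

End StructureFunctions.

Theorem theorem1 (R : realType) :
  exists P : 'I_4 -> 'I_4 -> 'I_4 -> dpoly,
  forall (M : manifold R 4) (D : tdistribution M)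
    (g : M -> 'rV[R]_4 -> 'rV[R]_4 -> R)
    (oM : M -> 4.-tuple 'rV[R]_4 -> Prop)
    (oD : M -> 2.-tuple 'rV[R]_4 -> Prop),
  engel D g ->
  orientation (fun=> fullv) oM ->
  orientation D oD ->
  exists X : 'I_4 -> vfield M,
  [/\ canonical_frame D g oM oD X,
      forall Y : 'I_4 -> vfield M,
        canonical_frame D g oM oD Y -> Y = X,
      let X1 := X (idx 1) in let X2 := X (idx 2) in
      let X3 := X (idx 3) in let X4 := X (idx 4) in
      let C k i j := structure_fun X (idx i) (idx j) (idx k) in
      let T1 := (C 4 1 4)%N in let T2 := (C 3 2 3)%N in
      let T3 := (C 3 1 4)%N in let T4 := (C 2 2 3)%N in
      let T5 := (C 2 1 4)%N in let T6 := (C 1 2 3)%N in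
      let C1_14 := (C 1 1 4)%N in let C1_34 := (C 1 3 4)%N in
      let C2_34 := (C 2 3 4)%N in let C3_34 := (C 3 3 4)%N in
      (* E/2 is forced in C1_14 and C3_34 by the X4-component of the Jacobi
         identity for X1, X3, X4; it vanishes when T1 and T2 are constant. *)
      let E := dir X1 (fun q => dir X2 T1 q - 2 * dir X1 T2 q) in
      forall p,
      [/\ lie X1 X4 p = C1_14 p *: X1 p + T5 p *: X2 p
                        + T3 p *: X3 p + T1 p *: X4 p,
          lie X2 X3 p = T6 p *: X1 p + T4 p *: X2 p + T2 p *: X3 p,
          lie X2 X4 p = dir X1 T6 p *: X1 p + dir X1 T4 p *: X2 p
                        + (T4 p + dir X1 T2 p) *: X3 p + T2 p *: X4 p,
          lie X3 X4 p = C1_34 p *: X1 p + C2_34 p *: X2 p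
                        + C3_34 p *: X3 p
                        + (T4 p + 2 * dir X1 T2 p - dir X2 T1 p) *: X4 p &
          [/\ C1_14 p =
                2^-1 * (T1 p * T4 p + T1 p * dir X1 T2 p - 3 * dir X1 T4 p
                        + dir X2 T3 p + dir X3 T1 p - dir X1 (dir X1 T2) p
                        + E p),
              C3_34 p =
                - 2^-1 * (T1 p * T4 p + T1 p * dir X1 T2 p - dir X1 T4 p
                          + dir X2 T3 p - dir X3 T1 p - dir X1 (dir X1 T2) p
                          - E p),
              C2_34 p = T2 p * T5 p - T3 p * T4 p - T1 p * dir X1 T4 p
                          - dir X2 T5 p + dir X1 (dir X1 T4) p &
              C1_34 p = T2 p * C1_14 p - T6 p * T3 p
                          - T1 p * dir X1 T6 p - dir X2 C1_14 p
                          + dir X1 (dir X1 T6) p]] &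
      forall i j k, structure_fun X i j k = dpoly_eval X (P i j k)].
Proof.
(* The polynomials are given before the manifold is introduced, so one family serves all
   structures. *)
exists structure_dpoly => M D g oM oD eD orM orD.
have [X1 [X2 aX]] := adapted_global eD orM orD.
have [F cF] : exists F, canonical_frame D g oM oD F.
  exact: ex_intro _ _ (adapted_canonical orM aX).
exists F; split.
- exact: cF.
- by move=> Y cY; exact: (canonical_unique eD orM orD cY cF).
- exact: (canonical_equations cF).
- by move=> i j k; exact: (structure_dpolyE cF i j k).
Qed.
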